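(* Let $n\in\mathbb{N}$, $p\in(1,\infty)$, and let $\nu$ be a finite signed Radon measure on $\mathbb{R}^n$, regarded as an element of $\mathcal{S}'(\mathbb{R}^n)$. Suppose that $\nu\in\bigcup_{\alpha\in(0,1)}W^{-\alpha,p}(\mathbb{R}^n)$ and $$\liminf_{\alpha\to0^+}\alpha\|\nu\|_{W^{-\alpha,p}}^p<\infty .$$ Then $\nu$ is absolutely continuous with respect to the $n$-dimensional Lebesgue measure. More precisely, there exists $f_\nu\in L^p(\mathbb{R}^n)$ such that $\nu=f_\nu\,dx$ and $$\lim_{\alpha\to0^+}\alpha\|\nu\|_{W^{-\alpha,p}}^p=\frac{2}{p}\|f_\nu\|_{L^p}^p .$$
   Context: $\mathbb{N}$ is the set of positive integers; $\|\cdot\|$ is the Euclidean norm on $\mathbb{R}^n$; $L^p(\mathbb{R}^n)$ is the Lebesgue space with respect to Lebesgue measure, with norm $\|\cdot\|_{L^p}$; $\mathcal{S}'(\mathbb{R}^n)$ is the space of tempered distributions. For $\alpha\in(0,1)$ and $q\in(1,\infty)$, $W^{\alpha,q}(\mathbb{R}^n)$ is the fractional Sobolev space of all $g\in L^q(\mathbb{R}^n)$ with $\int_{\mathbb{R}^n}\int_{\mathbb{R}^n}\frac{|g(x)-g(y)|^q}{\|x-y\|^{n+\alpha q}}\,dx\,dy<\infty$. For $p\in(1,\infty)$ and $\alpha\in(0,1)$, the negative Sobolev space $W^{-\alpha,p}(\mathbb{R}^n)$ is the dual space of $W^{\alpha,q}(\mathbb{R}^n)$, where $\frac1p+\frac1q=1$;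 since Schwartz functions are dense in $W^{\alpha,q}(\mathbb{R}^n)$, its elements are regarded as tempered distributions. For $t>0$ the heat kernel is $\Phi_t(x)=(4\pi t)^{-n/2}\exp\left(-\frac{\|x\|^2}{4t}\right)$, $x\in\mathbb{R}^n$. For $\alpha\in(0,1)$, the space $W^{-\alpha,p}(\mathbb{R}^n)$ is equipped with the (equivalent) norm $$\|f\|_{W^{-\alpha,p}}=\left(\int_0^1\left(t^{\alpha/2}\|f\ast\Phi_t\|_{L^p}\right)^p\frac{dt}{t}\right)^{1/p},$$ where $\ast$ denotes convolution (of a tempered distribution with a Schwartz function). Convention: $\|f\|_{W^{-\alpha,p}}=+\infty$ if $f\notin W^{-\alpha,p}(\mathbb{R}^n)$. *)

(* Defs.v *)
From HB Require Import structures.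
From mathcomp Require Import all_boot all_order all_algebra.
From mathcomp Require Import all_classical all_reals all_analysis.
From mathcomp Require Import measurable_realfun.

Set Implicit Arguments.
Unset Strict Implicit.
Unset Printing Implicit Defensive.

Import Order.TTheory GRing.Theory Num.Theory.
Import numFieldNormedType.Exports.

Local Open Scope classical_set_scope.
Local Open Scope ring_scope.

(* R^n is 'rV[R]_n with its Borel sigma-algebra.  Its library norm `|x| is the
   sup norm; the Euclidean norm is [enorm] below. *)
Section borel_matrix.
Context (R : realType) (m n : nat).

HB.instance Definition _ :=
  @isMeasurable.Build (sigma_display (@open 'M[R]_(m, n))) 'M[R]_(m, n)
    <<s @open 'M[R]_(m, n) >>
    (@sigma_algebra0 _ setT _) (@sigma_algebraC _ _)
    (@sigma_algebra_bigcup _ setT _).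

End borel_matrix.

Section borel_rV.
Context (R : realType) (n : nat).

Lemma measurable_open_rV (A : set 'rV[R]_n) : open A -> measurable A.
Proof. exact: sub_sigma_algebra. Qed.

Lemma continuous_measurable_rV (f : 'rV[R]_n -> R) :
  continuous f -> measurable_fun setT f.
Proof.
move=> /continuousP cf; apply: (measurability _ (RGenOpens.measurableE R)).
move=> _ [_ [a [b ->] <-]]; rewrite setTI; apply: measurable_open_rV.
exact/cf/interval_open.
Qed.

Lemma open_bigcup_rat_ball (U : set 'rV[R]_n) : open U ->
  U = \bigcup_(qk : 'rV[rat]_n * nat)
        [set x | ball (map_mx ratr qk.1 : 'rV[R]_n) qk.2.+1%:R^-1 x /\
           ball (map_mx ratr qk.1 : 'rV[R]_n) qk.2.+1%:R^-1 `<=` U].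
Proof.
move=> oU; apply/seteqP; split=> [x Ux|x [qk _ [xq]]]; last exact.
have /nbhs_ballP[e /= e0 eU] : nbhs x U by apply: open_nbhs_nbhs.
have [k ke] : exists k : nat, k.+1%:R^-1 + k.+1%:R^-1 < e :> R.
  near \oo => k; exists k.
  have -> : e = e / 2 + e / 2 by rewrite -splitr.
  by apply: ltrD; near: k; apply: near_infty_natSinv_lt (PosNum _);
    rewrite divr_gt0.
have k0 : 0 < k.+1%:R^-1 :> R by rewrite invr_gt0.
have qP i : exists q : rat, `|ratr q - x ord0 i| < k.+1%:R^-1.
  have : x ord0 i - k.+1%:R^-1 < x ord0 i + k.+1%:R^-1.
    by rewrite ltrBlDr -addrA ltrDl addr_gt0.
  move=> /rat_in_itvoo[q]; rewrite in_itv/= => /andP[q1 q2].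
  by exists q; rewrite ltr_distl q1.
have xq : ball (map_mx ratr (\row_i projT1 (cid (qP i))) : 'rV[R]_n)
    k.+1%:R^-1 x.
  split => // i j; rewrite (ord1 i) /ball/= !mxE.
  by case: cid => q /=.
exists (\row_i projT1 (cid (qP i)), k) => //=; split => // y qy.
apply: eU; apply: le_ball (ltW ke) _ _.
by apply: ball_triangle qy; exact: ball_sym.
Unshelve. all: by end_near. Qed.

Lemma measurable_fun_rV d (T : measurableType d) (f : T -> 'rV[R]_n) :
  (forall i, measurable_fun setT (fun x => f x ord0 i)) ->
  measurable_fun setT f.
Proof.
move=> mf; apply: (measurability (@open 'rV[R]_n)) => // _ [U oU <-].
rewrite setTI (open_bigcup_rat_ball oU) preimage_bigcup.
apply: countable_bigcupT_measurable => //= -[q k] /=.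
have [qU|qU] := pselect (ball (map_mx ratr q : 'rV[R]_n) k.+1%:R^-1 `<=` U);
    last first.
  by rewrite (_ : _ @^-1` _ = set0)//; apply/seteqP; split => // x -[].
rewrite (_ : _ @^-1` _ = \bigcap_(i in [set: 'I_n])
    ((fun x => f x ord0 i) @^-1` ball (ratr (q ord0 i) : R) k.+1%:R^-1)).
  apply: fin_bigcap_measurable => // i _.
  by rewrite -[X in measurable X]setTI; apply: mf => //; exact: measurable_ball.
apply/seteqP; split => [x [[_ xq] _] i _|x xq] /=.
  by have := xq ord0 i; rewrite mxE.
split => //; split; first by rewrite invr_gt0.
by move=> i j; rewrite ord1 mxE; exact: xq.
Qed.

End borel_rV.

Section lebesgue_rV.
Context (R : realType).

Definition rV_cons n (z : measurableTypeR R * 'rV[R]_n) : 'rV[R]_n.+1 :=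
  \row_i if unlift ord0 i is Some j then z.2 ord0 j else z.1.

Definition rV_uncons n (x : 'rV[R]_n.+1) : measurableTypeR R * 'rV[R]_n :=
  (x ord0 ord0, \row_i x ord0 (lift ord0 i)).

Lemma rV_cons0 n z : @rV_cons n z ord0 ord0 = z.1.
Proof. by rewrite mxE unlift_none. Qed.

Lemma rV_consS n z i : @rV_cons n z ord0 (lift ord0 i) = z.2 ord0 i.
Proof. by rewrite mxE liftK. Qed.

Lemma rV_consK n : cancel (@rV_cons n) (@rV_uncons n).
Proof.
case=> a v; congr pair; first exact: rV_cons0.
by apply/rowP => i; rewrite mxE rV_consS.
Qed.

Lemma measurable_rV_cons n : measurable_fun setT (@rV_cons n).
Proof.
apply: measurable_fun_rV => i; case: (unliftP ord0 i) => [j|] ->.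
  under eq_fun do rewrite rV_consS.
  apply: (@measurableT_comp _ _ _ _ _ _ (fun v : 'rV[R]_n => v ord0 j) _ snd);
    last exact: measurable_snd.
  by apply: continuous_measurable_rV => x; exact: coord_continuous.
by under eq_fun do rewrite rV_cons0; exact: measurable_fst.
Qed.

HB.instance Definition _ n := isMeasurableFun.Build _ _ _ _
  (@rV_cons n) (@measurable_rV_cons n).

Lemma measurable_rV_uncons n : measurable_fun setT (@rV_uncons n).
Proof.
apply: measurable_fun_pair => /=.
  by apply: continuous_measurable_rV => x; exact: coord_continuous.
apply: measurable_fun_rV => i; under eq_fun do rewrite mxE.
by apply: continuous_measurable_rV => x; exact: coord_continuous.
Qed.

Section step.
Context (n : nat) (mu : {sigma_finite_measure set 'rV[R]_n -> \bar R}).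

Definition lebesgue_rV_step : set 'rV[R]_n.+1 -> \bar R :=
  pushforward (@lebesgue_measure R \x mu)%E (@rV_cons n).

Let step0 : lebesgue_rV_step set0 = 0%E. Proof. exact: measure0. Qed.

Let step_ge0 A : (0 <= lebesgue_rV_step A)%E. Proof. exact: measure_ge0. Qed.

Let step_sigma_additive : semi_sigma_additive lebesgue_rV_step.
Proof. exact: measure_semi_sigma_additive. Qed.

HB.instance Definition _ := isMeasure.Build _ _ _ lebesgue_rV_step
  step0 step_ge0 step_sigma_additive.

Let step_sigma_finite : sigma_finite setT lebesgue_rV_step.
Proof.
have /sigma_finiteP[F [TF ndF Foo]] := sigma_finiteT (@lebesgue_measure R).
have /sigma_finiteP[G [TG ndG Goo]] := sigma_finiteT mu.
exists (fun k => @rV_uncons n @^-1` (F k `*` G k)).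
  rewrite -preimage_bigcup (_ : \bigcup_k _ = setT) ?preimage_setT//.
  apply/seteqP; split => // -[x y] _.
  have [i _ Fix] : (\bigcup_i F i) x by rewrite -TF.
  have [j _ Gjy] : (\bigcup_i G i) y by rewrite -TG.
  exists (maxn i j) => //; split => /=.
  - by move: x Fix; exact/subsetPset/ndF/leq_maxl.
  - by move: y Gjy; exact/subsetPset/ndG/leq_maxr.
move=> k; have [mFk Fkoo] := Foo k; have [mGk Gkoo] := Goo k.
split.
  rewrite -[X in measurable X]setTI; apply: measurable_rV_uncons => //.
  exact: measurableX.
rewrite /lebesgue_rV_step /pushforward -comp_preimage.
rewrite (_ : _ \o _ = id); last by apply/funext => z /=; rewrite rV_consK.
by rewrite preimage_id product_measure1E// lte_mul_pinfty// ge0_fin_numE.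
Qed.

HB.instance Definition _ :=
  Measure_isSigmaFinite.Build _ _ _ lebesgue_rV_step step_sigma_finite.

End step.

Fixpoint lebesgue_rV n : {sigma_finite_measure set 'rV[R]_n -> \bar R} :=
  if n is n'.+1 then lebesgue_rV_step (lebesgue_rV n') else \d_(0 : 'rV[R]_0).

Lemma lebesgue_rV_box n (a b : 'rV[R]_n) :
  (forall i, a ord0 i <= b ord0 i) ->
  lebesgue_rV n [set x | forall i, a ord0 i <= x ord0 i <= b ord0 i] =
  (\prod_(i < n) (b ord0 i - a ord0 i))%:E.
Proof.
elim: n a b => [a b _|n ih a b ab] /=.
  by rewrite big_ord0 diracE mem_set// => -[].
rewrite /lebesgue_rV_step /pushforward (_ : _ @^-1` _ =
    `[a ord0 ord0, b ord0 ord0] `*`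
    [set x : 'rV_n | forall i, (rV_uncons a).2 ord0 i <= x ord0 i
                                 <= (rV_uncons b).2 ord0 i]).
  rewrite product_measure1E//=.
  - rewrite ih => [|i]; last by rewrite !mxE.
    rewrite lebesgue_measure_itv/= lte_fin big_ord_recl EFinM; congr *%E.
      case: ltP => // ba; rewrite (_ : b _ _ = a ord0 ord0) ?subrr//.
      by apply/eqP; rewrite eq_le ba ab.
    by congr EFin; apply: eq_bigr => i _; rewrite !mxE.
  - rewrite (_ : mkset _ = \bigcap_(i in [set: 'I_n])
        ((fun x : 'rV[R]_n => x ord0 i) @^-1`
          `[(rV_uncons a).2 ord0 i, (rV_uncons b).2 ord0 i])); last first.
      apply/seteqP; split => [x xab i _|x xab i].
        by rewrite /= in_itv/=; exact: xab.
      by have := xab i I; rewrite /= in_itv.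
    apply: fin_bigcap_measurable => // i _; rewrite -[X in measurable X]setTI.
    suff : measurable_fun setT (fun x : 'rV[R]_n => x ord0 i).
      by apply => //; exact: measurable_itv.
    by apply: continuous_measurable_rV => x; exact: coord_continuous.
apply/seteqP; split => -[x y] /=; rewrite in_itv/=.
  move=> h; split; first by have := h ord0; rewrite rV_cons0.
  by move=> i; have := h (lift ord0 i); rewrite rV_consS !mxE.
move=> [hx hy] i; case: (unliftP ord0 i) => [j|] ->; last by rewrite rV_cons0.
by rewrite rV_consS; have := hy j; rewrite !mxE.
Qed.

End lebesgue_rV.

Section euclidean.
Context (R : realType) (n : nat).
Implicit Types x : 'rV[R]_n.

Definition enorm x : R := Num.sqrt (\sum_(i < n) x ord0 i ^+ 2).

Definition heat_kernel (t : R) x : R :=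
  (4 * pi * t) `^ (- (n%:R / 2)) * expR (- (enorm x ^+ 2 / (4 * t))).

End euclidean.

(* All functions and distributions are real-valued: the measure is real, and
   so are the heat kernels it is convolved with. *)
Section tempered.
Context (R : realType) (n : nat).
Implicit Types (phi psi : 'rV[R]_n -> R) (T : ('rV[R]_n -> R) -> R).

(* The iterated partial derivative along the coordinates listed in [s]. *)
Definition partials (s : seq 'I_n) phi : 'rV[R]_n -> R :=
  foldr (fun i psi x => 'D_('e_i) psi x) phi s.

Definition smooth phi := forall s,
  continuous (partials s phi) /\
  forall i x, derivable (partials s phi) x 'e_i.

Definition schwartz : set ('rV[R]_n -> R) := [set phi | smooth phi /\
  forall (k : nat) s, exists C, forall x,
    enorm x ^+ k * `|partials s phi x| <= C].

(* The increasing sequence of norms defining the topology of [schwartz]. *)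
Definition schwartz_norm (N : nat) phi : R :=
  sup [set y | exists (k : nat) s x,
    [/\ (k <= N)%N, (size s <= N)%N & y = enorm x ^+ k * `|partials s phi x|]].

(* A distribution is a functional on all functions, of which only the
   values on [schwartz] are meaningful. *)
Definition tempered : set (('rV[R]_n -> R) -> R) := [set T |
  (forall a phi psi, schwartz phi -> schwartz psi ->
     T (fun x => a * phi x + psi x) = a * T phi + T psi) /\
  exists C N, forall phi, schwartz phi -> `|T phi| <= C * schwartz_norm N phi].

Definition convolution T phi (x : 'rV[R]_n) : R := T (fun y => phi (x - y)).

End tempered.

Section charge_distribution.
Context d (T : measurableType d) (R : realType).
Variable nu : {charge set T -> \bar R}.

Lemma hahn_pair : {PN : set T * set T | hahn_decomposition nu PN.1 PN.2}.
Proof.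
by apply: cid; have [P [N PN]] := Hahn_decomposition nu; exists (P, N).
Qed.

Definition charge_integral (f : T -> R) : R :=
  \int[jordan_pos (svalP hahn_pair)]_x f x -
  \int[jordan_neg (svalP hahn_pair)]_x f x.

Definition has_density (mu : {measure set T -> \bar R}) (f : T -> R) :=
  mu.-integrable setT (EFin \o f) /\
  forall A, measurable A -> nu A = (\int[mu]_(x in A) (f x)%:E)%E.

End charge_distribution.

Section charge_tempered.
Context (R : realType) (n : nat).

Lemma schwartz_bounded (phi : 'rV[R]_n -> R) :
  schwartz phi -> forall x, `|phi x| <= schwartz_norm 0 phi.
Proof.
move=> [_ /(_ 0%N [::])[C phiC]] x; rewrite /schwartz_norm.
apply: sup_upper_bound.
  split; first by exists (enorm x ^+ 0 * `|phi x|), 0%N, [::], x.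
  exists C => _ [k [s [y [k0 s0 ->]]]].
  move: k0; rewrite leqn0 => /eqP ->.
  move: s0; rewrite leqn0 size_eq0 => /eqP ->; exact: phiC.
by exists 0%N, [::], x; rewrite expr0 mul1r.
Qed.

Lemma schwartz_integrable (mu : {finite_measure set 'rV[R]_n -> \bar R}) phi :
  schwartz phi -> mu.-integrable setT (EFin \o phi).
Proof.
move=> Sphi; apply: measurable_bounded_integrable => //.
- by rewrite -ge0_fin_numE// fin_num_measure.
- by apply: continuous_measurable_rV; have [/(_ [::])[]] := Sphi.
- exists (schwartz_norm 0 phi); split; first exact: num_real.
  by move=> M /ltW + x _; apply: le_trans; exact: schwartz_bounded.
Qed.

Lemma charge_tempered (nu : {charge set 'rV[R]_n -> \bar R}) :
  tempered (charge_integral nu).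
Proof.
rewrite /charge_integral; set mp := jordan_pos _; set mn := jordan_neg _.
split=> [a phi psi Sphi Spsi|].
  have lin (mu : {finite_measure set 'rV[R]_n -> \bar R}) :
      \int[mu]_x (a * phi x + psi x) =
      a * \int[mu]_x phi x + \int[mu]_x psi x.
    have iphi := schwartz_integrable mu Sphi.
    have ipsi := schwartz_integrable mu Spsi.
    rewrite RintegralD//; first by rewrite RintegralZl.
    exact: (integrableZl measurableT a iphi).
  by rewrite !lin mulrBr opprD addrACA.
exists (fine (mp setT) + fine (mn setT)), 0%N => phi Sphi.
have bnd (mu : {finite_measure set 'rV[R]_n -> \bar R}) :
    `|\int[mu]_x phi x| <= fine (mu setT) * schwartz_norm 0 phi.
  have iphi := schwartz_integrable mu Sphi.
  apply: le_trans (le_normr_Rintegral _ iphi) _ => //.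
  rewrite mulrC -Rintegral_cst//; apply: le_Rintegral => //.
  - exact: integrable_norm.
  - exact: finite_measure_integrable_cst.
  - by move=> x _; exact: schwartz_bounded.
by rewrite (le_trans (ler_normB _ _))// mulrDl lerD// bnd.
Qed.

End charge_tempered.

Section sobolev.
Context (R : realType) (n : nat).
Implicit Types (alpha p q : R) (g h : 'rV[R]_n -> R).
Implicit Types (L T : ('rV[R]_n -> R) -> R).
Local Notation leb := (lebesgue_rV R n).

Definition gagliardo alpha q g : \bar R :=
  (\int[leb]_x \int[leb]_y
    (`|g x - g y| `^ q / enorm (x - y) `^ (n%:R + alpha * q))%:E)%E.

Definition sobolev alpha q : set ('rV[R]_n -> R) :=
  [set g | g \in Lfun leb q%:E /\ (gagliardo alpha q g < +oo)%E].

Definition sobolev_norm alpha q g : \bar R :=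
  (('N[leb]_q%:E[EFin \o g] `^ q + gagliardo alpha q g) `^ q^-1)%E.

(* Boundedness makes such an L constant on almost everywhere equality
   classes, i.e. a functional on the quotient space. *)
Definition sobolev_dual alpha q : set (('rV[R]_n -> R) -> R) := [set L |
  (forall a g h, sobolev alpha q g -> sobolev alpha q h ->
     L (fun x => a * g x + h x) = a * L g + L h) /\
  exists C : R, forall g, sobolev alpha q g ->
    ((`|L g|)%:E <= C%:E * sobolev_norm alpha q g)%E].

Definition neg_sobolev alpha p : set (('rV[R]_n -> R) -> R) := [set T |
  tempered T /\
  exists2 L, sobolev_dual alpha (1 - p^-1)^-1 L &
    forall phi, schwartz phi -> T phi = L phi].

Definition neg_sobolev_norm alpha p T : \bar R :=
  if `[< neg_sobolev alpha p T >] then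
    ((\int[@lebesgue_measure R]_(t in `]0%R, 1%R[)
       (((t `^ (alpha / 2))%:E *
         'N[leb]_p%:E[EFin \o convolution T (heat_kernel t)]) `^ p *
        (t^-1)%:E)) `^ p^-1)%E
  else +oo%E.

End sobolev.

(* Main.v *)
Require Import Defs.
From HB Require Import structures.
From mathcomp Require Import all_boot all_order all_algebra.
From mathcomp Require Import all_classical all_reals all_analysis.
From mathcomp Require finmap.
From mathcomp Require Import measurable_realfun ring lra.

(* Let F(t) be the p-th power of the L^p norm of nu * Phi_t, so that
   alpha ||nu||^p = alpha int_0^1 t^(alpha p / 2 - 1) F(t) dt.  The weight
   alpha t^(alpha p / 2 - 1) has total mass 2/p and concentrates at t = 0, so a
   finite liminf forces F(t) <= C for some t arbitrarily close to 0.

   Whenever F(t) <= C along times tending to 0, Young's inequality gives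
   int phi dnu <= C/p + (1/q) int |phi|^q dx, first for phi bounded continuous
   (as Phi_t * phi -> phi) and then, continuous functions being dense in L^1 of
   a finite measure, for measurable phi.  Large multiples of indicators of null
   sets show that nu = f dx, and phi = sgn f |f|^(p-1) shows int |f|^p <= C.
   Applied with every C that F takes as an upper bound along some sequence of
   times, this also says that the lower limit of F at 0 is at least int |f|^p;
   Jensen's inequality gives F <= int |f|^p, and the limit follows by
   averaging. *)

Import Order.TTheory GRing.Theory Num.Theory.
Import numFieldNormedType.Exports.

Set Implicit Arguments.
Unset Strict Implicit.
Unset Printing Implicit Defensive.

Local Open Scope classical_set_scope.
Local Open Scope ring_scope.

(** * Integrals of powers near 0 *)

(** Young's inequality is used additively, with [phi] left unnormalized, for two reasons. Its left
    side is linear in [phi], while its right side does not see [phi] on a Lebesgue-null set, so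
    scaling alone excludes a singular part. And for phi = sgn f |f|^(p-1) both phi f and |phi|^q
    equal |f|^p, so that I <= C/p + I/q gives I <= C with no loss. This sharpness lets the same
    bound identify the limit: any constant that F meets at times tending to 0 dominates int |f|^p
    itself, not a multiple of it.

    The passage to measurable test functions meets an obstacle: Lebesgue measure is infinite, and
    one approximation must serve it and both Jordan parts of nu. Test functions are therefore
    written w g with w a Gaussian and g bounded. Then g is approximated in L^1 of the finite measure
    w d|nu| + w^q dx, and the bound on g turns closeness there into closeness of the q-th powers. *)

(** The integral of a nonnegative function is a supremum over the simple functions below it, and
    this supremum is monotone whether or not the functions are measurable. It serves for integrands
    in [t] built from an arbitrary nonnegative [F]. *)
Lemma ge0_le_integral_nonmeasurable d (T : measurableType d) (R : realType)
    (mu : {measure set T -> \bar R}) (D : set T) (f g : T -> \bar R) :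
  (forall x, D x -> 0 <= f x)%E -> (forall x, D x -> f x <= g x)%E ->
  (\int[mu]_(x in D) f x <= \int[mu]_(x in D) g x)%E.
Proof.
move=> f0 fg.
rewrite !ge0_integralE//; last by move=> x Dx; exact: le_trans (f0 _ Dx) (fg _ Dx).
apply: le_ereal_sup => _ [h hf <-]; exists h => // x.
by apply: le_trans (hf x) _; rewrite /patch; case: ifPn => // /set_mem; exact: fg.
Qed.

Lemma integral_powR_segment (R : realType) (s a b : R) : 0 < s -> 0 < a < b ->
  (\int[lebesgue_measure]_(t in `[a, b]) (t `^ (s - 1))%:E =
   (b `^ s / s - a `^ s / s)%:E)%E.
Proof.
move=> s0 /andP[a0 ab].
have pos x : a <= x -> x \in `]0, +oo[%R.
  by move=> ax; rewrite in_itv/= andbT; exact: lt_le_trans ax.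
have drv x r : a <= x -> derivable (fun t => powR t r : R) x 1.
  by move=> /pos; exact: derivable_powR.
have cnt x r : a <= x -> {for x, continuous (fun t => powR t r : R)}.
  by move=> ax; apply/differentiable_continuous/derivable1_diffP/drv.
have cntF x : a <= x -> {for x, continuous (fun t => t `^ s / s)}.
  by move=> ax; apply: cvgM; [exact: cnt|exact: cvg_cst].
rewrite (@continuous_FTC2 _ _ (fun t => t `^ s / s))//.
- apply: continuous_in_subspaceT => x; rewrite inE/= in_itv/= => /andP[ax _].
  exact: cnt.
- split.
  + move=> x; rewrite in_itv/= => /andP[/ltW ax _]; apply: derivableM => //.
    exact: drv.
  + by apply: cvg_at_right_filter; exact: cntF.
  + by apply: cvg_at_left_filter; apply: cntF; exact: ltW.
- move=> x; rewrite in_itv/= => /andP[/ltW ax _].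
  rewrite derive1E deriveM//; last exact: drv.
  rewrite derive_cst scaler0 add0r -derive1E powR_derive1 ?pos//.
  by rewrite /GRing.scale/= mulrA mulVf ?mul1r// gt_eqF.
Qed.

Lemma integral_powR (R : realType) (s b : R) : 0 < s -> 0 < b ->
  (\int[lebesgue_measure]_(t in `]0%R, b[) (t `^ (s - 1))%:E = (b `^ s / s)%:E)%E.
Proof.
move=> s0 b0.
rewrite integral_itv_bndo_bndc; last first.
  apply/measurable_EFinP/measurable_funTS.
  exact: measurable_powR.
(* The shift by 2 keeps [b / k.+2%:R] strictly below [b], as the formula on a segment requires. *)
pose F (k : nat) : set R := `[b / k.+2%:R, b]%classic.
have FE : \bigcup_k F k = `]0%R, b]%classic.
  apply/seteqP; split=> [x [k _]|x]; rewrite /F/= !in_itv/=.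
    by move=> /andP[+ ->]; rewrite andbT; apply: lt_le_trans; rewrite divr_gt0.
  move=> /andP[x0 xb]; have := near_infty_natSinv_lt (PosNum (divr_gt0 x0 b0)).
  move=> [N _ /(_ N (leqnn _))] /= Nx; exists N => //=; rewrite in_itv/= xb andbT.
  rewrite mulrC -ler_pdivlMr//; apply: le_trans (ltW Nx).
  by rewrite lef_pV2 ?posrE// ler_nat.
have ndF : nondecreasing_seq F.
  move=> i j ij; apply/subsetPset => x; rewrite /F/= !in_itv/= => /andP[+ ->].
  rewrite andbT; apply: le_trans.
  by rewrite ler_pM2l// lef_pV2 ?posrE// ler_nat ltnS.
have mF k : measurable (F k) by exact: measurable_itv.
have := @ge0_nondecreasing_set_cvg_integral _ (measurableTypeR R) _ F (fun t => (t `^ (s - 1))%:E)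
  lebesgue_measure ndF mF.
have mf : measurable_fun [set: measurableTypeR R] (fun t : R => (t `^ (s - 1))%:E).
  by apply/measurable_EFinP; exact: measurable_powR.
move=> /(_ (fun k => measurable_funTS mf)) /(_ (fun _ _ _ => powR_ge0 _ _)).
rewrite FE => cvint.
have /cvg_lim <- // := cvint; apply/cvg_lim => //.
have -> : (fun i => \int[lebesgue_measure]_(x in F i) (x `^ (s - 1))%:E)%E =
   (fun i => (b `^ s / s - (b / i.+2%:R) `^ s / s)%:E).
  apply/funext => i; rewrite /F integral_powR_segment// divr_gt0//=.
  by rewrite ltr_pdivrMr// ltr_pMr// ltr1n.
apply: cvg_EFin; first exact: nearW.
rewrite -[X in _ --> X](subr0 (b `^ s / s)).
apply: cvgB; first exact: cvg_cst.
rewrite -[X in _ --> X](mul0r s^-1); apply: cvgM; last exact: cvg_cst.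
have /cvg_at_rightP := powR_cvg0 s0; apply; split.
  by move=> k; rewrite divr_gt0.
rewrite -[X in _ --> X](mulr0 b); apply: cvgM; first exact: cvg_cst.
have := @cvg_harmonic R; rewrite -(cvg_shiftS (@harmonic R)); exact.
Qed.

Section abelian_limit.
Context (R : realType).
Implicit Types (F : R -> \bar R) (s c L p : R).
Local Notation mu := (@lebesgue_measure R).

Lemma le_integral_powR_near0 s c d F : 0 < s -> 0 <= c -> 0 < d <= 1 ->
  (forall t, (0 <= F t)%E) -> (forall t, 0 < t < d -> (c%:E <= F t)%E) ->
  ((c * (d `^ s / s))%:E <=
   \int[mu]_(t in `]0%R, 1%R[) ((t `^ (s - 1))%:E * F t))%E.
Proof.
move=> s0 c0 /andP[d0 d1] F0 cF.
have mw : measurable_fun [set: measurableTypeR R] (fun t : R => (t `^ (s - 1))%:E).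
  by apply/measurable_EFinP; exact: measurable_powR.
rewrite EFinM -(integral_powR s0 d0) -ge0_integralZl_EFin//; last 2 first.
  by move=> x _; rewrite lee_fin powR_ge0.
  exact: measurable_funTS.
rewrite integral_mkcond [leRHS]integral_mkcond.
apply: ge0_le_integral_nonmeasurable => t _; rewrite /patch.
  by case: ifPn => // _; rewrite mule_ge0// lee_fin powR_ge0.
case: ifPn => [|_]; last first.
  by case: ifPn => // _; rewrite mule_ge0// lee_fin powR_ge0.
rewrite inE/= in_itv/= => /andP[t0 td].
rewrite mem_set/= ?in_itv/= ?t0 ?(lt_le_trans td)// muleC.
by rewrite lee_wpmul2l ?lee_fin ?powR_ge0// cF ?t0.
Qed.

Lemma integral_powR_le s L F : 0 < s -> 0 <= L ->
  (forall t, (0 <= F t)%E) -> (forall t, 0 < t < 1 -> (F t <= L%:E)%E) ->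
  (\int[mu]_(t in `]0%R, 1%R[) ((t `^ (s - 1))%:E * F t) <= (L / s)%:E)%E.
Proof.
move=> s0 L0 F0 FL.
have mw : measurable_fun [set: measurableTypeR R] (fun t : R => (t `^ (s - 1))%:E).
  by apply/measurable_EFinP; exact: measurable_powR.
have := integral_powR s0 (@ltr01 R); rewrite powR1 div1r => i1.
rewrite EFinM -i1 -ge0_integralZl_EFin//; last 2 first.
  by move=> x _; rewrite lee_fin powR_ge0.
  exact: measurable_funTS.
apply: ge0_le_integral_nonmeasurable => t /=.
  by move=> _; rewrite mule_ge0// lee_fin powR_ge0.
rewrite in_itv/= => /FL tL.
by rewrite muleC lee_wpmul2r ?lee_fin ?powR_ge0.
Qed.

(** For d <= 1 this power is the share of the mass of t^(a p / 2 - 1) on (0, 1) that lies in (0, d).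
    Its limit 1 expresses the concentration of the weight at 0. *)
Lemma cvg_powR_exponent0 p d : 0 < d -> d `^ (a * p / 2) @[a --> 0^'+] --> (1 : R).
Proof.
move=> d0.
have -> : (fun a => d `^ (a * p / 2)) = (fun a => expR (a * (p / 2 * ln d))).
  by apply/funext => a; rewrite /powR gt_eqF//; congr expR; ring.
rewrite [X in _ --> X](_ : _ = expR (0 * (p / 2 * ln d))); last first.
  by rewrite mul0r expR0.
apply: cvg_at_right_filter.
apply: (@continuous_cvg _ _ _ _ _ (fun a => a * (p / 2 * ln d)) expR); first exact: continuous_expR.
by apply: cvgM; [exact: cvg_id|exact: cvg_cst].
Qed.

(** The upper bound 2/p L holds for each [a > 0], by the total mass of the weight; only the lower
    bound uses the concentration at 0. *)
Lemma cvg_integral_powR_abel p L F : 0 < p -> 0 <= L ->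
  (forall t, (0 <= F t)%E) -> (forall t, 0 < t < 1 -> (F t <= L%:E)%E) ->
  (forall c, c < L -> \forall t \near 0^'+, (c%:E <= F t)%E) ->
  (a%:E * \int[mu]_(t in `]0%R, 1%R[) ((t `^ (a * p / 2 - 1))%:E * F t))%E
    @[a --> 0^'+] --> (2 / p * L)%:E.
Proof.
move=> p0 L0 F0 FL cF.
set I := fun a : R => _.
have ub a : 0 < a -> (I a <= (2 / p * L)%:E)%E.
  move=> a0; rewrite /I (_ : 2 / p * L = a * (L / (a * p / 2))); last first.
    by field; rewrite !gt_eqF.
  rewrite EFinM lee_wpmul2l ?lee_fin ?(ltW a0)//.
  have sp : 0 < a * p / 2 by rewrite divr_gt0// mulr_gt0.
  exact: integral_powR_le sp L0 F0 FL.
have lb a : 0 < a -> (0 <= I a)%E.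
  move=> a0; rewrite mule_ge0 ?lee_fin ?(ltW a0)// integral_ge0// => t _.
  by rewrite mule_ge0// lee_fin powR_ge0.
have fI a : 0 < a -> I a \is a fin_num.
  by move=> a0; rewrite ge0_fin_numE ?lb// (le_lt_trans (ub _ a0))// ltry.
apply/fine_cvgP; split.
  by near=> a; apply: fI; near: a; exact: nbhs_right_gt.
apply/cvgrPdist_le => e e0.
pose c := Num.max 0 (L - e * p / 4).
(* Lowering [L] by [e * p / 4] costs e/2 after the factor 2/p, which leaves e/2 for the limit of the
   power of [dl]. If the lowered level is not positive, the bounds 0 and 2/p L are already within
   e/2 of each other. *)
have [L1|L1] := leP L (e * p / 4).
  near=> a.
  have a0 : 0 < a by near: a; exact: nbhs_right_gt.
  have := ub _ a0; have := lb _ a0; rewrite -(fineK (fI _ a0)) !lee_fin /= => h1 h2.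
  have h3 : 2 / p * L <= 2 / p * (e * p / 4) by rewrite ler_pM2l// divr_gt0.
  have h4 : 2 / p * (e * p / 4) = e / 2 by field; rewrite gt_eqF.
  by rewrite ger0_norm; lra.
have c0 : 0 < L - e * p / 4 by rewrite subr_gt0.
have ep : 0 < e * p / 4 by rewrite divr_gt0// mulr_gt0.
have /cF : L - e * p / 4 < L by lra.
move=> [d /= d0 dF].
pose dl := Num.min d 1.
have dl0 : 0 < dl by rewrite lt_min d0 ltr01.
have cd : 2 / p * (L - e * p / 4) * dl `^ (a * p / 2) @[a --> 0^'+] -->
    2 / p * (L - e * p / 4).
  rewrite -[X in _ --> X]mulr1; apply: cvgM; first exact: cvg_cst.
  exact: cvg_powR_exponent0.
have e2 : 0 < e / 2 by rewrite divr_gt0.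
move/cvgrPdist_le : cd => /(_ _ e2) cd.
near=> a.
have a0 : 0 < a by near: a; exact: nbhs_right_gt.
have h1 := ub _ a0.
have h2 : ((a * ((L - e * p / 4) * (dl `^ (a * p / 2) / (a * p / 2))))%:E <= I a)%E.
  rewrite EFinM lee_wpmul2l ?lee_fin ?(ltW a0)//.
  apply: le_integral_powR_near0 => //.
  - by rewrite divr_gt0// mulr_gt0.
  - exact: ltW.
  - by rewrite dl0 ge_min lexx orbT.
  - move=> t /andP[t0]; rewrite lt_min => /andP[td t1].
    by apply: dF => //=; rewrite sub0r normrN gtr0_norm.
move: h1 h2; rewrite -(fineK (fI _ a0)) !lee_fin /= => h1.
have -> : a * ((L - e * p / 4) * (dl `^ (a * p / 2) / (a * p / 2))) =
   2 / p * (L - e * p / 4) * dl `^ (a * p / 2).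
  by field; rewrite !gt_eqF.
move=> h2.
have h3 : `|2 / p * (L - e * p / 4) - 2 / p * (L - e * p / 4) * dl `^ (a * p / 2)| <= e / 2.
  by near: a; exact: cd.
have h4 : 2 / p * (L - e * p / 4) = 2 / p * L - e / 2 by field; rewrite gt_eqF.
move: h3; rewrite h4 ler_norml => /andP[_ h3].
rewrite h4 in h2.
rewrite ger0_norm; lra.
Unshelve. all: by end_near. Qed.

(* With C := (M + 1) p: were F above C on a whole interval (0, d), the integrals
   would be at least 2 (M + 1) d^(a p / 2), which tends to 2 (M + 1). *)
Lemma frequently_le_integral_powR p M F : 0 < p -> 0 <= M ->
  (forall t, (0 <= F t)%E) ->
  (forall e, 0 < e -> exists2 a, 0 < a < e &
     (a%:E * \int[mu]_(t in `]0%R, 1%R[) ((t `^ (a * p / 2 - 1))%:E * F t)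
      <= M%:E)%E) ->
  exists C, 0 <= C /\
    forall e, 0 < e -> exists2 t, 0 < t < e & (F t <= C%:E)%E.
Proof.
move=> p0 M0 F0 H; exists ((M + 1) * p); split.
  by rewrite mulr_ge0 ?addr_ge0// ltW.
move=> e e0; apply: contrapT => He.
pose d := Num.min e 1.
have d0 : 0 < d by rewrite lt_min e0 ltr01.
have cF t : 0 < t < d -> (((M + 1) * p)%:E <= F t)%E.
  move=> /andP[t0]; rewrite lt_min => /andP[te t1].
  rewrite leNgt; apply/negP => /ltW Ft; apply: He; exists t => //.
  by rewrite t0.
have cd := cvg_powR_exponent0 p d0.
have e2 : 0 < 2^-1 :> R by [].
move/cvgrPdist_le : cd => /(_ _ e2) [k /= k0 kd].
have [a /andP[a0 ak] aM] := H _ k0.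
have := kd a; rewrite /= sub0r normrN gtr0_norm// => /(_ ak a0).
rewrite ler_norml => /andP[_ hd].
have := @le_integral_powR_near0 (a * p / 2) ((M + 1) * p) d F.
move=> /(_ _ _ _ F0 cF).
rewrite divr_gt0 ?mulr_gt0// mulr_ge0 ?addr_ge0 ?(ltW p0)//.
rewrite d0 ge_min lexx orbT => /(_ erefl erefl erefl) h.
have a0' : (0 <= a%:E)%E by rewrite lee_fin ltW.
have := le_trans (lee_wpmul2l a0' h) aM.
rewrite -EFinM lee_fin.
have -> : a * ((M + 1) * p * (d `^ (a * p / 2) / (a * p / 2))) =
  2 * (M + 1) * d `^ (a * p / 2) by field; rewrite !gt_eqF.
have M1 : 0 < M + 1 by lra.
have := ler_wpM2l (ltW M1) hd; lra.
Qed.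

Lemma poweR_weight p a t (N : \bar R) : 0 < p -> 0 < t -> (0 <= N)%E ->
  (((t `^ (a / 2))%:E * N) `^ p * (t^-1)%:E =
   (t `^ (a * p / 2 - 1))%:E * N `^ p)%E.
Proof.
move=> p0 t0 N0; rewrite poweRM ?lee_fin ?powR_ge0// poweR_EFin -powRrM.
rewrite muleAC -EFinM; congr (_%:E * _)%E.
rewrite powRB; last by rewrite (gt_eqF t0) implybT.
by rewrite powRr1 ?ltW//; congr (_ `^ _ / _); ring.
Qed.

End abelian_limit.

(** * The heat kernel *)

Section heat_kernel.
Context (R : realType).
Implicit Types (t : R) (n : nat).

Lemma measurable_coord n (i : 'I_n) : measurable_fun setT (fun x : 'rV[R]_n => x ord0 i).
Proof. by apply: continuous_measurable_rV => x; exact: coord_continuous. Qed.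

Lemma measurable_prod_coord n (h : 'I_n -> R -> R) :
  (forall i, measurable_fun setT (h i)) ->
  measurable_fun setT (fun x : 'rV[R]_n => \prod_(i < n) h i (x ord0 i)).
Proof.
move=> mh; apply: measurable_prod => i _.
exact: measurableT_comp (mh i) (measurable_coord i).
Qed.

(** [lebesgue_rV] is built by adjoining one coordinate at a time through [rV_cons], so Tonelli
    splits off the first factor and induction handles the rest. *)
Lemma integral_prod_coord n (h : 'I_n -> R -> R) :
  (forall i, measurable_fun setT (h i)) -> (forall i u, 0 <= h i u) ->
  (forall i, \int[lebesgue_measure]_u (h i u)%:E = 1)%E ->
  (\int[lebesgue_rV R n]_x (\prod_(i < n) h i (x ord0 i))%:E = 1)%E.
Proof.
elim: n h => [|n ih] h mh h0 h1 /=.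
  under eq_integral do rewrite big_ord0.
  by rewrite integral_cst// mul1e; exact: diracT.
rewrite /lebesgue_rV_step ge0_integral_pushforward//; last 2 first.
- by apply/measurable_EFinP; exact: measurable_prod_coord.
- by move=> x _; rewrite lee_fin prodr_ge0.
rewrite preimage_setT.
have E z : ((fun x : 'rV[R]_n.+1 => (\prod_(i < n.+1) h i (x ord0 i))%:E) \o @rV_cons R n) z =
   ((h ord0 z.1)%:E * (\prod_(i < n) h (lift ord0 i) (z.2 ord0 i))%:E)%E.
  rewrite /= big_ord_recl rV_cons0 EFinM; congr (_ * _%:E)%E.
  by apply: eq_bigr => i _; rewrite rV_consS.
under eq_integral do rewrite E.
have mt := measurable_prod_coord (fun i => mh (lift ord0 i)).
rewrite fubini_tonelli1//=; last 2 first.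
- apply/emeasurable_funM; apply/measurable_EFinP.
    exact: measurableT_comp (mh ord0) measurable_fst.
  exact: measurableT_comp mt measurable_snd.
- by move=> x; rewrite mule_ge0// lee_fin// prodr_ge0.
rewrite /fubini_F /=.
under eq_integral => u _.
  rewrite ge0_integralZl_EFin//; last 2 first.
    by move=> x _; rewrite lee_fin prodr_ge0.
    exact/measurable_EFinP.
  rewrite (ih (fun i => h (lift ord0 i)))// mule1.
  over.
exact: h1.
Qed.

Lemma sqr_enorm n (x : 'rV[R]_n) : enorm x ^+ 2 = \sum_(i < n) x ord0 i ^+ 2.
Proof. by rewrite sqr_sqrtr// sumr_ge0// => i _; exact: sqr_ge0. Qed.

(** The heat kernel is the joint density of independent Gaussians of variance 2t centered at the
    coordinates of [y]. This reduces its total mass to the one-dimensional normal law. *)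
Lemma heat_kernel_prod n t (x y : 'rV[R]_n) : 0 < t ->
  heat_kernel t (x - y) =
  \prod_(i < n) normal_pdf (y ord0 i) (Num.sqrt (2 * t)) (x ord0 i).
Proof.
move=> t0; have t2 : 0 < 2 * t by rewrite mulr_gt0.
have s0 : Num.sqrt (2 * t) != 0 by rewrite gt_eqF// sqrtr_gt0.
rewrite (eq_bigr (fun i => normal_peak (Num.sqrt (2 * t)) *
    expR (- ((x ord0 i - y ord0 i) ^+ 2 / (4 * t))))); last first.
  move=> i _; rewrite normal_pdfE// /normal_fun sqr_sqrtr ?ltW//.
  congr (_ * expR _); rewrite mulNr; congr (- (_ / _)).
  by rewrite -mulr_natl; ring.
rewrite big_split/= prodr_const card_ord -expR_sum; congr (_ * expR _).
  rewrite /normal_peak sqr_sqrtr ?ltW// (_ : 2 * t * pi *+ 2 = 4 * pi * t); last first.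
    by rewrite -mulr_natl; ring.
  rewrite -powR12_sqrt; last by rewrite !mulr_ge0 ?pi_ge0 ?ltW.
  rewrite -powRN -powR_mulrn ?powR_ge0// -powRrM; congr (_ `^ _).
  by field.
rewrite sqr_enorm mulr_suml -sumrN; apply: eq_bigr => i _.
by rewrite !mxE.
Qed.

Lemma heat_kernel_ge0 n t (x : 'rV[R]_n) : 0 <= heat_kernel t x.
Proof. by rewrite mulr_ge0 ?powR_ge0 ?expR_ge0. Qed.

Lemma heat_kernel_gt0 n t (x : 'rV[R]_n) : 0 < t -> 0 < heat_kernel t x.
Proof. by move=> t0; rewrite mulr_gt0 ?expR_gt0// powR_gt0// !mulr_gt0 ?pi_gt0. Qed.

Lemma heat_kernelB n t (x y : 'rV[R]_n) : heat_kernel t (x - y) = heat_kernel t (y - x).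
Proof.
suff E : enorm (x - y) = enorm (y - x) by rewrite /heat_kernel E.
rewrite /enorm; have -> // : \sum_i (x - y) ord0 i ^+ 2 = \sum_i (y - x) ord0 i ^+ 2.
by apply: eq_bigr => i _; rewrite !mxE -sqrrN opprB.
Qed.

Lemma integral_heat_kernel n t (y : 'rV[R]_n) : 0 < t ->
  (\int[lebesgue_rV R n]_x (heat_kernel t (x - y))%:E = 1)%E.
Proof.
move=> t0; under eq_integral do rewrite heat_kernel_prod//.
apply: (@integral_prod_coord n (fun i => normal_pdf (y ord0 i) (Num.sqrt (2 * t)))) => i *.
- exact: measurable_normal_pdf.
- exact: normal_pdf_ge0.
- exact: integral_normal_pdf.
Qed.

Lemma heat_kernel_le n t (x : 'rV[R]_n) : 0 < t ->
  heat_kernel t x <= (4 * pi * t) `^ (- (n%:R / 2)).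
Proof.
move=> t0; rewrite ler_piMr ?powR_ge0// -expR0 ler_expR oppr_le0.
by rewrite divr_ge0 ?sqr_ge0// mulr_ge0// ltW.
Qed.

Lemma measurable_heat_kernelB n t : measurable_fun setT
  (fun z : 'rV[R]_n * 'rV[R]_n => heat_kernel t (z.1 - z.2)).
Proof.
apply: measurable_funM; first exact: measurable_cst.
apply: measurableT_comp; first exact: measurable_expR.
apply: measurableT_comp; first exact: oppr_measurable.
apply: measurable_funM; last exact: measurable_cst.
under eq_fun do rewrite sqr_enorm.
apply: measurable_sum => i; under eq_fun do rewrite !mxE.
apply: measurable_funX; apply: measurable_funB.
- exact: measurableT_comp (measurable_coord i) measurable_fst.
- exact: measurableT_comp (measurable_coord i) measurable_snd.
Qed.

(** Half of the exponent |x|^2/(4t) pays for the decay factor; the other half is the exponent of the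
    kernel at time 2t, which still has integral one, and 2^(n/2) is the ratio of the two
    normalizations. The hypothesis bears on a single coordinate because it describes the complement
    of a sup-norm ball. *)
Lemma heat_kernel_tail n t d (x : 'rV[R]_n) : 0 < t -> 0 <= d ->
  (exists i, d <= `|x ord0 i|) ->
  heat_kernel t x <= 2 `^ (n%:R / 2) * expR (- (d ^+ 2 / (8 * t))) * heat_kernel (2 * t) x.
Proof.
move=> t0 d0 [i di].
have dx : d ^+ 2 <= enorm x ^+ 2.
  rewrite sqr_enorm (bigD1 i)//= -[leLHS]addr0 lerD//.
    by rewrite -[leRHS]real_normK ?num_real// lerXn2r// nnegrE.
  by apply: sumr_ge0 => j _; exact: sqr_ge0.
have p0 : 0 < 4 * pi * t :> R by rewrite !mulr_gt0 ?pi_gt0.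
rewrite /heat_kernel (_ : 4 * pi * (2 * t) = 2 * (4 * pi * t)); last by ring.
rewrite (@powRM _ 2) ?(ltW p0)// [X in _ <= X](_ : _ = (4 * pi * t) `^ (- (n%:R / 2)) *
   (expR (- (d ^+ 2 / (8 * t))) * expR (- (enorm x ^+ 2 / (4 * (2 * t)))))); last first.
  rewrite (powRN 2); field.
  by rewrite gt_eqF// powR_gt0.
rewrite ler_wpM2l ?powR_ge0// -expRD ler_expR -opprD lerN2.
rewrite (_ : enorm x ^+ 2 / (4 * t) = enorm x ^+ 2 / (8 * t) + enorm x ^+ 2 / (4 * (2 * t))); last first.
  by field; rewrite gt_eqF.
by rewrite lerD2r ler_pM2r// invr_gt0 mulr_gt0.
Qed.

End heat_kernel.

(** * Integrals of bounded functions *)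

Section integration.
Context d (T : measurableType d) (R : realType).
Implicit Types K : R.

Lemma integrable_mul_bounded (mu : {measure set T -> \bar R}) (f g : T -> R) K :
  mu.-integrable setT (EFin \o f) -> measurable_fun setT g ->
  (forall x, `|g x| <= K) -> mu.-integrable setT (EFin \o (fun x => f x * g x)).
Proof.
move=> fi mg gK.
have mf : measurable_fun setT f by apply/measurable_EFinP; exact: measurable_int fi.
(* [T] may be empty, so [0 <= K] is available only at a given point. *)
have K0 (x : T) : 0 <= K by exact: le_trans (gK x).
apply: (@le_integrable _ _ _ _ _ _ _ (fun x => K%:E * (EFin \o f) x)%E) => //.
- by apply/measurable_EFinP; exact: measurable_funM.
- move=> x _ /=; rewrite lee_fin !normrM mulrC ler_pM// (ger0_norm (K0 x))//.
- exact: integrableZl.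
Qed.

Lemma bounded_integrable (mu : {finite_measure set T -> \bar R}) (g : T -> R) K :
  measurable_fun setT g -> (forall x, `|g x| <= K) ->
  mu.-integrable setT (EFin \o g).
Proof.
move=> mg gK; have i1 := finite_measure_integrable_cst mu 1 measurableT.
have := integrable_mul_bounded i1 mg gK.
by rewrite (_ : (fun x => _) = g)//; apply/funext => x; rewrite mul1r.
Qed.

Lemma integrable_ge0_lty (mu : {measure set T -> \bar R}) (f : T -> R) :
  measurable_fun setT f -> (forall x, 0 <= f x) ->
  (\int[mu]_x (f x)%:E < +oo)%E -> mu.-integrable setT (EFin \o f).
Proof.
move=> mf f0 fy; apply/integrableP; split; first exact/measurable_EFinP.
by under eq_integral do rewrite /= ger0_norm//.
Qed.

Lemma EFin_Rintegral (mu : {measure set T -> \bar R}) (f : T -> R) :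
  mu.-integrable setT (EFin \o f) ->
  ((\int[mu]_x f x)%R%:E = \int[mu]_x (f x)%:E)%E.
Proof. by move=> fi; rewrite /Rintegral fineK//; exact: integrable_fin_num fi. Qed.

Lemma bounded_cvg_Rintegral (mu : {finite_measure set T -> \bar R})
    (f_ : nat -> T -> R) (f : T -> R) K :
  (forall k, measurable_fun setT (f_ k)) -> measurable_fun setT f ->
  (forall x, f_ ^~ x @ \oo --> f x) -> (forall k x, `|f_ k x| <= K) ->
  \int[mu]_x f_ k x @[k --> \oo] --> \int[mu]_x f x.
Proof.
move=> mf_ mf cf bf.
have [|||||_ _ h] := @dominated_convergence _ _ _ mu setT measurableT
    (fun k => EFin \o f_ k) (EFin \o f) (cst K%:E).
- by move=> k; apply/measurable_EFinP.
- exact/measurable_EFinP.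
- by apply: aeW => x _; apply: cvg_EFin; [exact: nearW|exact: cf].
- exact: finite_measure_integrable_cst.
- by apply: aeW => x k _ /=; rewrite lee_fin.
have fK x : `|f x| <= K.
  have cfx : `|f_ k x| @[k --> \oo] --> `|f x| by apply: cvg_norm; exact: cf.
  rewrite -(cvg_lim _ cfx)//; apply: limr_le; first by apply/cvg_ex; exists `|f x|.
  exact: nearW.
apply: fine_cvg; rewrite EFin_Rintegral//; exact: bounded_integrable fK.
Qed.

End integration.

(** * Mollification by the heat kernel *)

Section mollification.
Context (R : realType) (n : nat).
Local Notation leb := (lebesgue_rV R n).
Implicit Types (t K : R) (phi : 'rV[R]_n -> R) (x y : 'rV[R]_n).

Lemma measurable_heat_kernelBl t y :
  measurable_fun setT (fun x : 'rV[R]_n => heat_kernel t (x - y)).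
Proof. exact: (measurableT_comp (measurable_heat_kernelB t) (pair2_measurable y)). Qed.

Lemma measurable_heat_kernelBr t x :
  measurable_fun setT (fun y : 'rV[R]_n => heat_kernel t (x - y)).
Proof. exact: (measurableT_comp (measurable_heat_kernelB t) (pair1_measurable x)). Qed.

Lemma integrable_heat_kernel t y : 0 < t ->
  leb.-integrable setT (EFin \o (fun x => heat_kernel t (x - y))).
Proof.
move=> t0; apply: integrable_ge0_lty.
- exact: measurable_heat_kernelBl.
- by move=> x; exact: heat_kernel_ge0.
- by rewrite integral_heat_kernel// ltry.
Qed.

Lemma Rintegral_heat_kernel t y : 0 < t ->
  \int[leb]_x heat_kernel t (x - y) = 1.
Proof. by move=> t0; rewrite /Rintegral integral_heat_kernel. Qed.

(** Since the kernel is even, this is its convolution with [phi]. The argument [x - y] is the one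
    that appears when Fubini moves the kernel from the measure to the test function. *)
Definition mollify t phi y := \int[leb]_x (heat_kernel t (x - y) * phi x).

Lemma mollify_le t phi K y : 0 < t -> measurable_fun setT phi ->
  (forall x, `|phi x| <= K) -> `|mollify t phi y| <= K.
Proof.
move=> t0 mphi phiK.
have ih := integrable_heat_kernel y t0.
have i1 := integrable_mul_bounded ih mphi phiK.
apply: le_trans (le_normr_Rintegral _ i1) _ => //.
rewrite -[leRHS]mulr1 -(Rintegral_heat_kernel y t0) -RintegralZl//.
apply: le_Rintegral => //.
- exact: integrable_norm.
- exact: (integrableZl measurableT K ih).
- move=> x _; rewrite normrM ger0_norm ?heat_kernel_ge0// mulrC.
  by rewrite ler_wpM2r// heat_kernel_ge0.
Qed.

(** Near [y] continuity bounds the error by e/2. Away from [y] the integrand is at most 2K times the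
    kernel, and the tail estimate replaces this by a small constant times a kernel of mass one. *)
Lemma cvg_mollify phi K y : continuous phi -> (forall x, `|phi x| <= K) ->
  mollify t phi y @[t --> 0^'+] --> phi y.
Proof.
move=> cphi phiK; have mphi := continuous_measurable_rV cphi.
have K0 : 0 <= K by exact: le_trans (phiK y).
apply/cvgrPdist_le => e e0; have e2 : 0 < e / 2 by rewrite divr_gt0.
have /cvgrPdist_le/(_ _ e2)/nbhs_ballP[d /= d0 dphi] := cphi y.
pose c t := 2 `^ (n%:R / 2) * expR (- (d ^+ 2 / (8 * t))).
have c0 t : 0 <= c t by rewrite mulr_ge0 ?powR_ge0 ?expR_ge0.
have key t : 0 < t -> `|phi y - mollify t phi y| <= e / 2 + 2 * K * c t.
  move=> t0; have t20 : 0 < 2 * t by rewrite mulr_gt0.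
  have ih := integrable_heat_kernel y t0; have ih2 := integrable_heat_kernel y t20.
  have i1 := integrable_mul_bounded ih mphi phiK.
  have mB : measurable_fun setT (fun x => phi y - phi x) by exact: measurable_funB.
  have bB x : `|phi y - phi x| <= K + K.
    by apply: le_trans (ler_normB _ _) _; rewrite lerD.
  have i2 := integrable_mul_bounded ih mB bB.
  have -> : phi y - mollify t phi y =
      \int[leb]_x (heat_kernel t (x - y) * (phi y - phi x)).
    rewrite -[X in X - _]mulr1 -(Rintegral_heat_kernel y t0) -RintegralZl// -RintegralB//.
      by apply: eq_Rintegral => x _; ring.
    exact: (integrableZl measurableT (phi y) ih).
  apply: le_trans (le_normr_Rintegral _ i2) _ => //.
  have ie := integrableZl measurableT (e / 2) ih.
  have ic := integrableZl measurableT (2 * K * c t) ih2.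
  have -> : e / 2 + 2 * K * c t = \int[leb]_x (e / 2 * heat_kernel t (x - y) +
      2 * K * c t * heat_kernel (2 * t) (x - y)).
    rewrite RintegralD// (RintegralZl _ measurableT ih) (RintegralZl _ measurableT ih2).
    by rewrite (Rintegral_heat_kernel y t0) (Rintegral_heat_kernel y t20) !mulr1.
  apply: le_Rintegral => //.
  - exact: integrable_norm.
  - exact: (integrableD measurableT ie ic).
  - move=> x _; rewrite normrM ger0_norm ?heat_kernel_ge0//.
    have [xd|xd] := pselect (ball y d x).
      apply: ler_wpDr.
        apply: mulr_ge0; last exact: heat_kernel_ge0.
        by apply: mulr_ge0 => //; exact: mulr_ge0.
      by rewrite mulrC ler_wpM2r ?heat_kernel_ge0//; exact: dphi.
    have : exists i, d <= `|(x - y) ord0 i|.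
      apply: contrapT => H; apply: xd; split => // i j; rewrite ord1.
      rewrite /ball/= distrC ltNge; apply/negP => dxy; apply: H; exists j.
      by rewrite !mxE.
    move=> /(heat_kernel_tail t0 (ltW d0)) tail.
    apply: ler_wpDl.
      by apply: mulr_ge0; [exact: ltW|exact: heat_kernel_ge0].
    rewrite mulrC -mulrA; apply: ler_pM => //; first exact: heat_kernel_ge0.
    by apply: le_trans (bB _) _; lra.
(* From exp u >= 1 + u >= u at u = d^2/(8t): the tail constant is at most a multiple of [t]. *)
have cle t : 0 < t -> 2 * K * c t <= 2 * K * (2 `^ (n%:R / 2) * (8 * t / d ^+ 2)).
  move=> t0; rewrite ler_wpM2l ?mulr_ge0// ler_wpM2l ?powR_ge0//.
  rewrite expRN -[leRHS]invf_div lef_pV2 ?posrE ?expR_gt0 ?divr_gt0 ?exprn_gt0 ?mulr_gt0//.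
  by apply: le_trans (expR_ge1Dx _); rewrite lerDr.
pose A := 2 * K * (2 `^ (n%:R / 2) * (8 / d ^+ 2)).
have A0 : 0 <= A.
  apply: mulr_ge0; first exact: mulr_ge0.
  by apply: mulr_ge0; [exact: powR_ge0|rewrite divr_ge0// sqr_ge0].
near=> t.
have t0 : 0 < t by near: t; exact: nbhs_right_gt.
apply: le_trans (key _ t0) _.
have tA : t <= e / 2 / (A + 1).
  by near: t; apply: nbhs_right_le; rewrite divr_gt0// ltr_wpDl.
have : 2 * K * c t <= A * t.
  by apply: le_trans (cle _ t0) _; rewrite /A le_eqVlt; apply/orP; left; apply/eqP; ring.
have : A * t <= e / 2.
  apply: (@le_trans _ _ ((A + 1) * t)); first by rewrite ler_wpM2r ?ltW// ltrDl.
  by rewrite mulrC -ler_pdivlMr// ltr_wpDl.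
lra.
Unshelve. all: by end_near. Qed.

End mollification.

(** * Duality with continuous test functions *)

Section heat_flow.
Context (R : realType) (n : nat).
Local Notation leb := (lebesgue_rV R n).
Implicit Types (m : {finite_measure set 'rV[R]_n -> \bar R}).
Implicit Types (t K : R) (phi : 'rV[R]_n -> R) (x y : 'rV[R]_n).

(** This is the convolution of m1 - m2 with the heat kernel. Keeping two finite measures apart lets
    Fubini and dominated convergence act on each of them. *)
Definition heat_flow m1 m2 t x : R :=
  \int[m1]_y heat_kernel t (x - y) - \int[m2]_y heat_kernel t (x - y).

Lemma integrable_heat_kernel_finite m t x : 0 < t ->
  m.-integrable setT (EFin \o (fun y => heat_kernel t (x - y))).
Proof.
move=> t0; apply: bounded_integrable (measurable_heat_kernelBr t x) _ => y.
by rewrite ger0_norm ?heat_kernel_ge0//; exact: heat_kernel_le.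
Qed.

(** Integrating first in the Lebesgue variable leaves at most [K] for each [y], since the kernel has
    mass one, and [m] is finite. *)
Lemma integrable_kernel_product m t phi K : 0 < t ->
  measurable_fun setT phi -> (forall x, `|phi x| <= K) ->
  (leb \x m)%E.-integrable setT
    (fun z => (heat_kernel t (z.1 - z.2) * phi z.1)%:E).
Proof.
move=> t0 mphi phiK.
have mf : measurable_fun setT (fun z : 'rV[R]_n * 'rV[R]_n =>
    (heat_kernel t (z.1 - z.2) * phi z.1)%:E).
  apply/measurable_EFinP/measurable_funM; first exact: measurable_heat_kernelB.
  exact: measurableT_comp mphi measurable_fst.
apply/integrable21ltyP => //.
apply: (@le_lt_trans _ _ (\int[m]_y K%:E)%E); last first.
  rewrite integral_cst// lte_mul_pinfty ?lee_fin//.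
    by apply: le_trans (phiK 0).
  by rewrite -ge0_fin_numE// fin_num_measure.
apply: ge0_le_integral_nonmeasurable => y _; first exact: integral_ge0.
have ih := integrable_heat_kernel y t0.
rewrite -[leRHS]mule1 -(integral_heat_kernel y t0) -integralZl//.
apply: ge0_le_integral_nonmeasurable => // x _ /=.
rewrite lee_fin normrM ger0_norm ?heat_kernel_ge0// mulrC.
by rewrite ler_wpM2r// heat_kernel_ge0.
Qed.

Lemma measurable_mollify t phi K : 0 < t ->
  measurable_fun setT phi -> (forall x, `|phi x| <= K) ->
  measurable_fun setT (mollify t phi).
Proof.
(* Only the inner Lebesgue integral matters here, so the measure on the other factor may be any
   finite one; [mzero] is taken. *)
move=> t0 mphi phiK; have i0 := integrable_kernel_product mzero t0 mphi phiK.
have := measurable_fubini_G i0 => mG.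
by apply: measurableT_comp mG.
Qed.

Lemma integral_kernel_swap m t phi K : 0 < t ->
  measurable_fun setT phi -> (forall x, `|phi x| <= K) ->
  leb.-integrable setT
    (EFin \o (fun x => phi x * \int[m]_y heat_kernel t (x - y))) /\
  \int[leb]_x (phi x * \int[m]_y heat_kernel t (x - y)) =
  \int[m]_y mollify t phi y.
Proof.
move=> t0 mphi phiK; have i0 := integrable_kernel_product m t0 mphi phiK.
have FE x : fubini_F m (fun z : 'rV[R]_n * 'rV[R]_n => (heat_kernel t (z.1 - z.2) * phi z.1)%:E) x =
   (phi x * \int[m]_y heat_kernel t (x - y))%:E.
  have ih := integrable_heat_kernel_finite m x t0.
  rewrite -RintegralZl// EFin_Rintegral.
    by apply: eq_integral => y _; rewrite /= mulrC.
  exact: (integrableZl measurableT (phi x) ih).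
have GE y : fubini_G leb (fun z : 'rV[R]_n * 'rV[R]_n => (heat_kernel t (z.1 - z.2) * phi z.1)%:E) y =
   (mollify t phi y)%:E.
  rewrite /mollify EFin_Rintegral//.
  exact: integrable_mul_bounded (integrable_heat_kernel y t0) mphi phiK.
split.
  by have := integrable_fubini_F i0; apply: eq_integrable => // x _; exact: FE.
congr fine; rewrite -(eq_integral _ _ (fun x _ => FE x)).
rewrite [LHS](Fubini i0); apply: eq_integral => y _; exact: GE.
Qed.

Lemma measurable_integral_heat_kernel m t : 0 < t ->
  measurable_fun setT (fun x => \int[m]_y heat_kernel t (x - y)).
Proof.
move=> t0.
have h1 (x : 'rV[R]_n) : `|cst 1 x : R| <= 1 by rewrite normr1.
have [/measurable_int/measurable_EFinP] :=
  integral_kernel_swap m t0 (measurable_cst (1 : R)) h1.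
by under eq_fun do rewrite mul1r.
Qed.

Lemma measurable_heat_flow m1 m2 t : 0 < t ->
  measurable_fun setT (heat_flow m1 m2 t).
Proof.
by move=> t0; apply: measurable_funB; exact: measurable_integral_heat_kernel.
Qed.

(* By Young's inequality for the pairing of [heat_flow t] with [phi], moved
   onto [phi] by Fubini. *)
Lemma test_mollify_le m1 m2 (p q C : R) phi K t : 0 < p -> 0 < q ->
  p^-1 + q^-1 = 1 -> 0 < t -> measurable_fun setT phi ->
  (forall x, `|phi x| <= K) ->
  (\int[leb]_x (`|heat_flow m1 m2 t x| `^ p)%:E <= C%:E)%E ->
  ((\int[m1]_y mollify t phi y - \int[m2]_y mollify t phi y)%:E <=
   (C / p)%:E + (q^-1)%:E * \int[leb]_x (`|phi x| `^ q)%:E)%E.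
Proof.
move=> p0 q0 pq t0 mphi phiK FC.
have [i1 <-] := integral_kernel_swap m1 t0 mphi phiK.
have [i2 <-] := integral_kernel_swap m2 t0 mphi phiK.
rewrite -RintegralB// EFin_Rintegral; last exact: (integrableB measurableT i1 i2).
have mu_ := measurable_heat_flow m1 m2 t0.
have mp : measurable_fun setT (fun x => (p^-1 * `|heat_flow m1 m2 t x| `^ p)%:E).
  apply/measurable_EFinP/measurable_funM => //.
  by apply: measurableT_comp (measurable_powR _) _; exact: measurableT_comp.
have mq : measurable_fun setT (fun x => (q^-1 * `|phi x| `^ q)%:E).
  apply/measurable_EFinP/measurable_funM => //.
  by apply: measurableT_comp (measurable_powR _) _; exact: measurableT_comp.
apply: le_trans (lee_abs _) _.
apply: le_trans (le_abse_integral _ _ _) _ => //.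
  by apply: measurable_int (integrableB measurableT i1 i2).
apply: (@le_trans _ _ (\int[leb]_x ((p^-1 * `|heat_flow m1 m2 t x| `^ p)%:E +
    (q^-1 * `|phi x| `^ q)%:E))%E).
  apply: ge0_le_integral_nonmeasurable => // x _.
  rewrite /= -EFinD lee_fin -mulrBr normrM mulrC.
  have := @conjugate_powR R `|heat_flow m1 m2 t x| `|phi x| p q (normr_ge0 _) (normr_ge0 _) p0 q0 pq.
  by rewrite ![_ / _]mulrC.
have pV : 0 <= p^-1 by rewrite invr_ge0 ltW.
have qV : 0 <= q^-1 by rewrite invr_ge0 ltW.
rewrite ge0_integralD//; last 2 first.
- by move=> x _; rewrite lee_fin mulr_ge0// powR_ge0.
- by move=> x _; rewrite lee_fin mulr_ge0// powR_ge0.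
apply: leeD.
  under eq_integral do rewrite EFinM.
  rewrite ge0_integralZl_EFin//; last first.
    apply/measurable_EFinP.
    by apply: measurableT_comp (measurable_powR _) _; exact: measurableT_comp.
  by rewrite [C / p]mulrC EFinM; apply: lee_wpmul2l => //; rewrite lee_fin.
under eq_integral do rewrite EFinM.
rewrite ge0_integralZl_EFin//; apply/measurable_EFinP.
by apply: measurableT_comp (measurable_powR _) _; exact: measurableT_comp.
Qed.

(** The right-hand side of [test_mollify_le] does not involve [t]. Hence only the left-hand side
    passes to the limit, along times t_k < 1/(k+1) at which the bound [C] holds, by dominated
    convergence with the constant [K]. *)
Lemma test_continuous_le m1 m2 (p q C : R) phi K : 0 < p -> 0 < q ->
  p^-1 + q^-1 = 1 -> continuous phi ->
  (forall x, `|phi x| <= K) ->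
  (forall e, 0 < e -> exists2 t, 0 < t < e &
    (\int[leb]_x (`|heat_flow m1 m2 t x| `^ p)%:E <= C%:E)%E) ->
  ((\int[m1]_y phi y - \int[m2]_y phi y)%:E <=
   (C / p)%:E + (q^-1)%:E * \int[leb]_x (`|phi x| `^ q)%:E)%E.
Proof.
move=> p0 q0 pq cphi phiK H; have mphi := continuous_measurable_rV cphi.
have e0 k : 0 < k.+1%:R^-1 :> R by rewrite invr_gt0.
have tP k : exists t, 0 < t < k.+1%:R^-1 /\
    (\int[leb]_x (`|heat_flow m1 m2 t x| `^ p)%:E <= C%:E)%E.
  by have [t ? ?] := H _ (e0 k); exists t.
pose t_ k := projT1 (cid (tP k)).
have t0 k : 0 < t_ k by have := projT2 (cid (tP k)) => -[/andP[]].
have tk k : t_ k < k.+1%:R^-1 by have := projT2 (cid (tP k)) => -[/andP[]].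
have tC k : (\int[leb]_x (`|heat_flow m1 m2 (t_ k) x| `^ p)%:E <= C%:E)%E.
  by have := projT2 (cid (tP k)) => -[].
have ct : t_ k @[k --> \oo] --> (0 : R).
  apply: (@squeeze_cvgr _ _ _ _ (cst 0) (@harmonic R)).
  - by apply: nearW => k; rewrite ltW//= ltW.
  - exact: cvg_cst.
  - exact: cvg_harmonic.
have cm m : \int[m]_y mollify (t_ k) phi y @[k --> \oo] --> \int[m]_y phi y.
  apply: (@bounded_cvg_Rintegral _ _ _ _ _ _ K) => //.
  - by move=> k; exact: measurable_mollify phiK.
  - by move=> y; have /cvg_at_rightP := cvg_mollify (y := y) cphi phiK; apply.
  - by move=> k y; exact: mollify_le.
have [->|Qoo] := eqVneq (\int[leb]_x (`|phi x| `^ q)%:E)%E +oo%E.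
  by rewrite gt0_muley ?lte_fin ?invr_gt0// addey ?leey.
have Qfin : (\int[leb]_x (`|phi x| `^ q)%:E)%E \is a fin_num.
  by rewrite ge0_fin_numE ?lt_neqAle ?Qoo ?leey// integral_ge0// => x _; rewrite lee_fin powR_ge0.
rewrite -(fineK Qfin) lee_fin.
have cB : (\int[m1]_y mollify (t_ k) phi y - \int[m2]_y mollify (t_ k) phi y)
    @[k --> \oo] --> (\int[m1]_y phi y - \int[m2]_y phi y).
  by apply: cvgB; exact: cm.
rewrite -(cvg_lim _ cB)//; apply: limr_le; first by apply/cvg_ex; eexists; exact: cB.
apply: nearW => k.
have := test_mollify_le p0 q0 pq (t0 k) mphi phiK (tC k).
by rewrite -{1}(fineK Qfin) lee_fin.
Qed.

End heat_flow.

(** * Density of continuous functions *)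

Section bounded_measurable.
Context d (T : measurableType d) (R : realType).
Implicit Types (f g h : T -> R) (a b c : R).

Definition bounded_measurable f :=
  measurable_fun setT f /\ exists K : R, forall x, `|f x| <= K.

Lemma bounded_measurable_cst c : bounded_measurable (fun _ => c).
Proof. by split; [exact: measurable_cst|exists `|c|]. Qed.

Lemma bounded_measurableD f g : bounded_measurable f -> bounded_measurable g ->
  bounded_measurable (fun x => f x + g x).
Proof.
move=> [mf [K fK]] [mg [L gL]]; split; first exact: measurable_funD.
by exists (K + L) => x; rewrite (le_trans (ler_normD _ _))// lerD.
Qed.

Lemma bounded_measurableM f g : bounded_measurable f -> bounded_measurable g ->
  bounded_measurable (fun x => f x * g x).
Proof.
move=> [mf [K fK]] [mg [L gL]]; split; first exact: measurable_funM.
by exists (K * L) => x; rewrite normrM ler_pM.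
Qed.

Lemma bounded_measurableB f g : bounded_measurable f -> bounded_measurable g ->
  bounded_measurable (fun x => f x - g x).
Proof.
move=> [mf [K fK]] [mg [L gL]]; split; first exact: measurable_funB.
by exists (K + L) => x; rewrite (le_trans (ler_normB _ _))// lerD.
Qed.

(* What the density argument uses of [f |-> \int |f|], stated for a functional
   so that it applies to a sum of integrals against different measures. *)
Definition integral_seminorm (N : (T -> R) -> R) :=
  (forall f g h a b, bounded_measurable f -> bounded_measurable g ->
     bounded_measurable h -> 0 <= a -> 0 <= b ->
     (forall x, `|f x| <= a * `|g x| + b * `|h x|) ->
     N f <= a * N g + b * N h) /\
  (forall (f_ : nat -> T -> R) K, (forall k, measurable_fun setT (f_ k)) ->
     (forall k x, `|f_ k x| <= K) -> (forall x, f_ ^~ x @ \oo --> 0) ->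
     N (f_ k) @[k --> \oo] --> 0).

Lemma integral_seminormD N M : integral_seminorm N -> integral_seminorm M ->
  integral_seminorm (fun f => N f + M f).
Proof.
move=> [N1 N2] [M1 M2]; split=> [f g h a b bf bg bh a0 b0 fgh|f_ K mf fK cf].
  rewrite !mulrDr addrACA; apply: lerD; first exact: N1.
  exact: M1.
rewrite -[X in _ --> X](addr0 0); apply: cvgD; first exact: N2 fK cf.
exact: M2 fK cf.
Qed.

Lemma integral_seminorm_weight (mu : {measure set T -> \bar R}) (w : T -> R) :
  mu.-integrable setT (EFin \o w) -> (forall x, 0 <= w x) ->
  integral_seminorm (fun f => \int[mu]_x (w x * `|f x|)).
Proof.
move=> wi w0.
have mw : measurable_fun setT w by apply/measurable_EFinP; exact: measurable_int wi.
have inte f : bounded_measurable f ->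
    mu.-integrable setT (EFin \o (fun x => w x * `|f x|)).
  move=> [mf [K fK]]; apply: (integrable_mul_bounded (K := K)) => //.
    exact: measurableT_comp.
  by move=> x; rewrite normr_id.
split=> [f g h a b bf bg bh a0 b0 fgh|f_ K mf fK cf].
  have ig := integrableZl measurableT a (inte _ bg).
  have ih := integrableZl measurableT b (inte _ bh).
  rewrite -(RintegralZl _ measurableT (inte _ bg)) -(RintegralZl _ measurableT (inte _ bh)).
  rewrite -RintegralD//; apply: le_Rintegral => //.
  - exact: inte.
  - exact: (integrableD measurableT ig ih).
  - move=> x _; apply: (@le_trans _ _ (w x * (a * `|g x| + b * `|h x|))).
      by rewrite ler_wpM2l.
    by rewrite le_eqVlt; apply/orP; left; apply/eqP; ring.
have [|||||_ _ H] := @dominated_convergence _ _ _ mu setT measurableT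
    (fun k => EFin \o (fun x => w x * `|f_ k x|)) (cst 0%E)
    (fun x => K%:E * (EFin \o w) x)%E.
- move=> k; apply/measurable_EFinP; apply: measurable_funM => //.
  exact: measurableT_comp.
- exact: measurable_cst.
- apply: aeW => x _; apply: cvg_EFin; first exact: nearW.
  rewrite -[X in _ --> X](mulr0 (w x)); apply: cvgM; first exact: cvg_cst.
  by rewrite -(normr0 R); apply: cvg_norm; exact: cf.
- exact: integrableZl.
- apply: aeW => x k _ /=; rewrite lee_fin normrM normr_id mulrC ger0_norm//.
  by rewrite ler_wpM2r.
rewrite integral0 in H.
by apply: fine_cvg.
Qed.

End bounded_measurable.

Import HBSimple HBNNSimple.

Section density.
Context (R : realType) (n : nat).
Variable N : ('rV[R]_n -> R) -> R.
Hypothesis sN : integral_seminorm N.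
Implicit Types (f g h : 'rV[R]_n -> R) (a b c e : R).

Let bounded_continuous_measurable g :
  continuous g -> (exists K : R, forall x, `|g x| <= K) -> bounded_measurable g.
Proof. by move=> cg bg; split => //; exact: continuous_measurable_rV. Qed.

(** The approximants are required to be bounded so that the class is stable under products; each may
    have its own bound. *)
Definition approximable f := bounded_measurable f /\
  forall e, 0 < e -> exists g,
    [/\ continuous g, exists K : R, forall x, `|g x| <= K & N (fun x => f x - g x) <= e].

Let approximable_continuous g :
  continuous g -> (exists K : R, forall x, `|g x| <= K) -> approximable g.
Proof.
move=> cg bg; split; first exact: bounded_continuous_measurable.
move=> e e0; exists g; split => //.
have b0 := @bounded_measurable_cst _ 'rV[R]_n R 0.
have bgg : bounded_measurable (fun x => g x - g x).
  by apply: bounded_measurableB; exact: bounded_continuous_measurable.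
have := sN.1 _ _ _ 0 0 bgg b0 b0 (lexx _) (lexx _).
rewrite !mul0r addr0 => H; apply: le_trans (H _) (ltW e0) => x.
by rewrite subrr normr0.
Qed.

Let approximableM f g : approximable f -> approximable g ->
  approximable (fun x => f x * g x).
Proof.
move=> [bf Hf] [bg Hg]; split; first exact: bounded_measurableM.
have [mf [K fK]] := bf.
move=> e e0.
have K0 : 0 <= K by apply: le_trans (fK 0).
have eK : 0 < e / 2 / (K + 1) by rewrite !divr_gt0// ltr_wpDl.
have [g' [cg' [L g'L] Ng]] := Hg _ eK.
have L0 : 0 <= L by apply: le_trans (g'L 0).
(* The approximant of [f] is chosen after that of [g], because its tolerance depends on the bound
   [L] of [g']. *)
have eL : 0 < e / 2 / (L + 1) by rewrite !divr_gt0// ltr_wpDl.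
have [f' [cf' [K' f'K] Nf]] := Hf _ eL.
exists (fun x => f' x * g' x); split.
- by move=> x; apply: continuousM; [exact: cf'|exact: cg'].
- by exists (K' * L) => x; rewrite normrM ler_pM.
have bf' : bounded_measurable f' by apply: bounded_continuous_measurable => //; exists K'.
have bg' : bounded_measurable g' by apply: bounded_continuous_measurable => //; exists L.
have := sN.1 (fun x => f x * g x - f' x * g' x) _ _ (K + 1) (L + 1)
  (bounded_measurableB (bounded_measurableM bf bg) (bounded_measurableM bf' bg'))
  (bounded_measurableB bg bg') (bounded_measurableB bf bf')
  (addr_ge0 K0 ler01) (addr_ge0 L0 ler01).
move=> H; apply: le_trans (H _) _.
  move=> x; have -> : f x * g x - f' x * g' x = f x * (g x - g' x) + g' x * (f x - f' x).
    by ring.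
  apply: le_trans (ler_normD _ _) _; rewrite !normrM; apply: lerD.
    by rewrite ler_wpM2r// (le_trans (fK x))// lerDl.
  by rewrite ler_wpM2r// (le_trans (g'L x))// lerDl.
rewrite [leRHS](splitr e); apply: lerD.
  by rewrite mulrC -ler_pdivlMr// ltr_wpDl.
by rewrite mulrC -ler_pdivlMr// ltr_wpDl.
Qed.

Let approximableD f g : approximable f -> approximable g ->
  approximable (fun x => f x + g x).
Proof.
move=> [bf Hf] [bg Hg]; split; first exact: bounded_measurableD.
move=> e e0; have e2 : 0 < e / 2 by rewrite divr_gt0.
have [f' [cf' [K f'K] Nf]] := Hf _ e2.
have [g' [cg' [L g'L] Ng]] := Hg _ e2.
exists (fun x => f' x + g' x); split.
- by move=> x; apply: continuousD; [exact: cf'|exact: cg'].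
- by exists (K + L) => x; rewrite (le_trans (ler_normD _ _))// lerD.
have bf' : bounded_measurable f' by apply: bounded_continuous_measurable => //; exists K.
have bg' : bounded_measurable g' by apply: bounded_continuous_measurable => //; exists L.
have := sN.1 (fun x => f x + g x - (f' x + g' x)) _ _ 1 1
  (bounded_measurableB (bounded_measurableD bf bg) (bounded_measurableD bf' bg'))
  (bounded_measurableB bf bf') (bounded_measurableB bg bg') ler01 ler01.
rewrite !mul1r => H; apply: le_trans (H _) _.
  move=> x; rewrite !mul1r; apply: le_trans (ler_normD _ _).
  by rewrite le_eqVlt; apply/orP; left; apply/eqP; congr (`|_|); ring.
by rewrite [leRHS](splitr e) lerD.
Qed.

Let approximable_cst c : approximable (fun _ => c).
Proof. by apply: approximable_continuous; [exact: cst_continuous|exists `|c|]. Qed.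

Let approximable_lim (f_ : nat -> 'rV[R]_n -> R) f (K : R) : (forall k, approximable (f_ k)) ->
  measurable_fun setT f -> (forall k x, `|f_ k x| <= K) -> (forall x, `|f x| <= K) ->
  (forall x, f_ ^~ x @ \oo --> f x) -> approximable f.
Proof.
move=> Hf mf f_K fK cf; split; first by split => //; exists K.
move=> e e0; have e2 : 0 < e / 2 by rewrite divr_gt0.
have mf_ k : measurable_fun setT (f_ k) by have [[]] := Hf k.
have bB k : bounded_measurable (fun x => f x - f_ k x).
  by apply: bounded_measurableB; split => //; exists K.
have : N (fun x => f x - f_ k x) @[k --> \oo] --> 0.
  apply: (sN.2 _ (K + K)).
  - by move=> k; have [] := bB k.
  - by move=> k x; rewrite (le_trans (ler_normB _ _))// lerD.
  - by move=> x; rewrite -(subrr (f x)); apply: cvgB; [exact: cvg_cst|exact: cf].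
move=> /cvgrPdist_le/(_ _ e2)[k _ /(_ k (leqnn k))] /=.
rewrite sub0r normrN => /(le_trans (ler_norm _)) Nk.
have [g [cg bg Ng]] := (Hf k).2 _ e2.
exists g; split => //.
have bmg := bounded_continuous_measurable cg bg.
have := sN.1 (fun x => f x - g x) _ _ 1 1
  (bounded_measurableB (conj mf (ex_intro _ K fK)) bmg)
  (bB k) (bounded_measurableB (Hf k).1 bmg) ler01 ler01.
rewrite !mul1r => H; apply: le_trans (H _) _.
  move=> x; rewrite !mul1r; apply: le_trans (ler_normD _ _).
  by rewrite le_eqVlt; apply/orP; left; apply/eqP; congr (`|_|); ring.
by rewrite [leRHS](splitr e) lerD.
Qed.

Let indic_bound (A : set 'rV[R]_n) x : `|\1_A x : R| <= 1.
Proof. by rewrite indicE; case: (_ \in _); rewrite ?normr0 ?normr1. Qed.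

(** The truncated multiples [u k] of the distance to the complement are continuous, vanish off the
    ball and are eventually 1 at each of its points. *)
Let approximable_indic_ball (c : 'rV[R]_n) (r : R) : approximable \1_(ball c r).
Proof.
pose u k x : R := Num.min 1 (k%:R * Num.max 0 (r - `|c - x|)).
have u01 k x : `|u k x| <= 1.
  rewrite ger0_norm ?ge_min ?lexx// le_min ler01/= mulr_ge0//.
  by rewrite le_max lexx.
have cu k : continuous (u k).
  move=> x.
  have cr : {for x, continuous (fun y : 'rV[R]_n => r - `|c - y|)}.
    apply: continuousB; first exact: cst_continuous.
    have cb : {for x, continuous (fun y : 'rV[R]_n => c - y)}.
      by apply: continuousB; [exact: cst_continuous|exact: cvg_id].
    exact: (continuous_comp cb (@norm_continuous R 'rV[R]_n (c - x))).
  have c0 := @cst_continuous 'rV[R]_n R 0 x.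
  have c1 := @cst_continuous 'rV[R]_n R 1 x.
  have ck := @cst_continuous 'rV[R]_n R k%:R x.
  exact: (continuous_min c1 (continuousM ck (continuous_max c0 cr))).
apply: (@approximable_lim u _ 1) => //.
- by move=> k; apply: approximable_continuous => //; exists 1.
- by apply: measurable_indic; apply: measurable_open_rV; exact: ball_open.
- move=> x; rewrite indicE; have [xr|xr] := pselect (ball c r x).
    rewrite (mem_set xr); move: xr; rewrite -ball_normE /ball_/= => xr.
    have xr0 : 0 < r - `|c - x| by rewrite subr_gt0.
    apply: cvg_near_cst.
    have [k kr] := ltr_add_invr xr.
    exists k.+2 => // j /= kj.
    rewrite /u (max_idPr (ltW xr0)); apply/min_idPl.
    rewrite -ler_pdivrMr// div1r.
    apply: (@le_trans _ _ k.+1%:R); last by rewrite ler_nat ltnW.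
    rewrite invf_ple ?posrE// ltW//.
    by move: kr; rewrite -ltrBrDl.
  rewrite (memNset xr); move: xr; rewrite -ball_normE /ball_/= => /negP; rewrite -leNgt => xr.
  apply: cvg_near_cst; apply: nearW => k; rewrite /u.
  by rewrite (max_idPl _) ?subr_le0// mulr0 (min_idPr _).
Qed.

(** The sets with approximable indicator form a sigma-algebra: 1 - f gives complements, and products
    with bounded limits give countable intersections. It contains the open sets, which are countable
    unions of balls with rational centers. *)
Let approximable_measurable_indic (A : set 'rV[R]_n) : measurable A -> approximable \1_A.
Proof.
pose D : set (set 'rV[R]_n) := [set B | measurable B /\ approximable \1_B].
have sub1 f : approximable f -> approximable (fun x => 1 - f x).
  move=> af; have := approximableD (approximable_cst 1)
    (approximableM (approximable_cst (-1)) af).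
  by congr approximable; apply/funext => x; rewrite mulN1r.
have DC B : D B -> D (~` B).
  move=> [mB aB]; split; first exact: measurableC.
  have := sub1 _ aB; congr approximable; apply/funext => x.
  by rewrite !indicE in_setC; case: (_ \in _); rewrite ?subr0 ?subrr.
have DU (F : nat -> set 'rV[R]_n) : (forall k, D (F k)) -> D (\bigcup_k F k).
  move=> DF; rewrite -[X in D X]setCK; apply: (DC); rewrite setC_bigcup; split.
    by apply: bigcap_measurable => // k _; apply: measurableC; have [] := DF k.
  (* Finite products of the indicators of the complements decrease to the indicator of the
     complement of the union. *)
  pose h k x : R := \prod_(i < k) \1_(~` F i) x.
  have h1 k x : `|h k x| <= 1.
    rewrite /h; elim: k => [|k ih]; first by rewrite big_ord0 normr1.
    by rewrite big_ord_recr/= normrM mulr_ile1.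
  apply: (@approximable_lim h _ 1) => //.
  - elim=> [|k ih].
      by rewrite (_ : h 0%N = fun _ => 1)//; apply/funext => x; rewrite /h big_ord0.
    have := approximableM ih (DC _ (DF k)).2; congr approximable.
    by apply/funext => x; rewrite /h big_ord_recr.
  - apply: measurable_indic; apply: bigcap_measurable => // k _.
    by apply: measurableC; have [] := DF k.
  - move=> x; rewrite indicE; have [xF|xF] := boolP (x \in _).
      apply: cvg_near_cst; apply: nearW => k; rewrite /h big1// => i _.
      by rewrite indicE mem_set//; move: xF; rewrite inE; exact.
    apply: cvg_near_cst.
    have [i Fi] : exists i, F i x.
      apply: contrapT => nF; move: xF; rewrite notin_setE; apply => i _ Fi.
      by apply: nF; exists i.
    exists i.+1 => // k /= ik; rewrite /h (bigD1 (Ordinal ik))//=.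
    by rewrite indicE memNset ?mul0r//=; apply.
have D0 : D set0.
  split; first exact: measurable0.
  by rewrite indic0; exact: approximable_cst.
suff : <<s @open 'rV[R]_n >> `<=` D by move=> sD mA; have [] := sD _ mA.
apply: smallest_sub.
  by split => // E DE; rewrite setTD; exact: DC.
move=> U oU; rewrite (open_bigcup_rat_ball oU).
pose B (qk : 'rV[rat]_n * nat) : set 'rV[R]_n :=
  ball (map_mx ratr qk.1 : 'rV[R]_n) qk.2.+1%:R^-1.
(* Closure is known for unions over [nat], so the pairs of center and radius are listed by their
   codes; a code of no pair, or of a ball not inside [U], contributes [set0]. *)
pose F k : set 'rV[R]_n := if unpickle k is Some qk then
  (if `[< B qk `<=` U >] then B qk else set0) else set0.
rewrite (_ : \bigcup_qk _ = \bigcup_k F k).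
  apply: DU => k; rewrite /F; case: unpickle => // qk; case: asboolP => // _.
  split; first by apply: measurable_open_rV; exact: ball_open.
  exact: approximable_indic_ball.
apply/seteqP; split=> [x [qk _ [Bx BU]]|x [k _]].
  by exists (pickle qk) => //; rewrite /F pickleK asboolT.
by rewrite /F; case: unpickle => // qk; case: asboolP => // BU Bx; exists qk.
Qed.

(** A nonnegative bounded function is a limit from below of simple functions; adding the constant
    [K] reduces the general case to this one. *)
Lemma approximable_bounded_measurable f : bounded_measurable f -> approximable f.
Proof.
have pos g (K : R) : measurable_fun setT g -> (forall x, 0 <= g x <= K) -> approximable g.
  move=> mg gK; have mEg : measurable_fun setT (EFin \o g) by apply/measurable_EFinP.
  pose s := nnsfun_approx measurableT mEg.
  have g0 x : setT x -> (0 <= (EFin \o g) x)%E.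
    by move=> _; rewrite lee_fin; have /andP[] := gK x.
  have sg k x : s k x <= g x.
    by rewrite -lee_fin nnsfun_approxE; exact: le_approx.
  apply: (@approximable_lim (fun k x => s k x) _ K) => //.
  - move=> k.
    rewrite (_ : (fun x => s k x) = fun x => \sum_(y <- finmap.enum_fset (fset_set (range (s k))))
       y * \1_((s k) @^-1` [set y]) x).
      elim: (finmap.enum_fset _) => [|y r ih].
        rewrite (_ : (fun x => _) = fun _ => 0); first exact: approximable_cst.
        by apply/funext => x; rewrite big_nil.
      rewrite (_ : (fun x => _) = fun x => y * \1_(s k @^-1` [set y]) x +
          \sum_(z <- r) z * \1_(s k @^-1` [set z]) x); last first.
        by apply/funext => x; rewrite big_cons.
      apply: approximableD ih; apply: approximableM; first exact: approximable_cst.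
      apply: approximable_measurable_indic.
      exact: measurable_sfunP.
    by apply/funext => x; rewrite [LHS]fimfunE fsbig_finite.
  - move=> k x; rewrite ger0_norm//; apply: le_trans (sg k x) _.
    by have /andP[] := gK x.
  - by move=> x; have /andP[g0' gK'] := gK x; rewrite ger0_norm.
  - move=> x; have := cvg_nnsfun_approx measurableT mEg g0 (x := x) I.
    by move=> /fine_cvgP[_].
move=> [mf [K fK]].
have : approximable (fun x => f x + K).
  apply: (pos _ (K + K)); first exact: measurable_funD.
  by move=> x; have := fK x; rewrite ler_norml; lra.
move=> /approximableD /(_ (approximable_cst (- K))); congr approximable.
by apply/funext => x; rewrite addrK.
Qed.

(** Clipping an approximant to [-K, K] brings it no farther from [f], whose values lie there.
    Retaining the same bound [K], independently of [e], is what later controls the q-th powers. *)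
Lemma continuous_dense f (K : R) : measurable_fun setT f -> (forall x, `|f x| <= K) ->
  forall e, 0 < e -> exists g,
    [/\ continuous g, forall x, `|g x| <= K & N (fun x => f x - g x) <= e].
Proof.
move=> mf fK e e0; have bf : bounded_measurable f by split => //; exists K.
have K0 : 0 <= K by apply: le_trans (fK 0).
have [_ /(_ _ e0)[g [cg bg Ng]]] := approximable_bounded_measurable bf.
pose g' x := Num.max (- K) (Num.min K (g x)).
have cg' : continuous g'.
  move=> x; have c1 := @cst_continuous 'rV[R]_n R (- K) x.
  have c2 := @cst_continuous 'rV[R]_n R K x.
  exact: (continuous_max c1 (continuous_min c2 (cg x))).
have g'K x : `|g' x| <= K.
  by rewrite ler_norml /g' le_max lexx/= ge_max ge_min lexx/= andbT; lra.
exists g'; split => //.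
have bmg := bounded_continuous_measurable cg bg.
have bmg' : bounded_measurable g' by apply: bounded_continuous_measurable => //; exists K.
have := sN.1 (fun x => f x - g' x) _ _ 1 0
  (bounded_measurableB bf bmg') (bounded_measurableB bf bmg)
  (bounded_measurable_cst _ 0) ler01 (lexx _).
rewrite mul1r !mul0r addr0 => H; apply: le_trans (H _) Ng => x.
rewrite mul1r addr0; have := fK x; rewrite ler_norml => /andP[f1 f2].
rewrite /g'; have [h1|h1] := leP K (g x); have [h2|h2] := leP (-K) (g x) => //.
- rewrite max_r; last by lra.
  rewrite ler0_norm; last by lra.
  by rewrite ler0_norm; lra.
- lra.
- by rewrite !ger0_norm; lra.
Qed.

End density.

(** * Duality with measurable test functions *)

Lemma conjugate_exponent (R : realType) (p q : R) : 0 < p -> 0 < q ->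
  p^-1 + q^-1 = 1 -> (p - 1) * q = p.
Proof.
move=> p0 q0 pq; have : p + q = p * q.
  by have /(congr1 (fun z => z * (p * q))) := pq; rewrite mul1r => <-; field; rewrite !gt_eqF.
by lra.
Qed.

(** Young's inequality for a and b^(q-1) is the tangent-line inequality b^q - a^q <= q b^(q-1) (b -
    a) of a convex function. Only [b] has to be bounded by [K]. *)
Lemma ler_powR_lipschitz (R : realType) (p q a b K : R) : 0 < p -> 0 < q ->
  p^-1 + q^-1 = 1 -> 0 <= a -> 0 <= b <= K ->
  b `^ q <= a `^ q + q * K `^ (q - 1) * `|b - a|.
Proof.
move=> p0 q0 pq a0 /andP[b0 bK].
have q1 : 0 < q - 1.
  have : 0 < p^-1 by rewrite invr_gt0.
  move=> pi; have : q^-1 < 1 by lra.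
  by rewrite invf_lt1// subr_gt0.
have qp : (q - 1) * p = q by rewrite (conjugate_exponent q0 p0)// addrC.
have qpV : q / p = q - 1 by rewrite -[X in X / p]qp mulfK// gt_eqF.
have Y := @conjugate_powR R a (b `^ (q - 1)) q p a0 (powR_ge0 _ _) q0 p0.
have {Y} := Y (etrans (addrC _ _) pq); rewrite -powRrM qp => Y.
have : b * b `^ (q - 1) = b `^ q by rewrite mulr_powRB1.
move: Y => /(ler_wpM2l (ltW q0)).
have -> : q * (a `^ q / q + b `^ q / p) = a `^ q + (q - 1) * b `^ q.
  by rewrite -qpV; field; rewrite !gt_eqF.
set B := b `^ (q - 1) => Y bB.
have : b `^ q - a `^ q <= q * B * (b - a).
  have -> : q * B * (b - a) = q * (b * B) - q * (a * B) by ring.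
  by rewrite bB; lra.
move=> H.
suff : q * B * (b - a) <= q * K `^ (q - 1) * `|b - a| by lra.
apply: (@le_trans _ _ (q * B * `|b - a|)).
  by rewrite ler_wpM2l ?ler_norm// mulr_ge0 ?powR_ge0// ltW.
rewrite ler_wpM2r// ler_wpM2l//; first exact: ltW.
by apply: ge0_ler_powR; rewrite ?nnegrE ?(ltW q1) ?(le_trans b0 bK).
Qed.

Section test_functions.
Context (R : realType) (n : nat).
Local Notation leb := (lebesgue_rV R n).
Implicit Types (m : {finite_measure set 'rV[R]_n -> \bar R}).
Implicit Types (K : R) (x y : 'rV[R]_n).

(** The kernel at time 1 serves as a continuous, bounded, integrable and strictly positive function;
    positivity allows dividing by it and recovering null sets from weighted integrals. *)
Definition weight x : R := heat_kernel 1 x.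
Definition weight_bound : R := (4 * pi * 1) `^ (- (n%:R / 2)).

Lemma weight_gt0 x : 0 < weight x. Proof. exact: heat_kernel_gt0. Qed.

Lemma weight_ge0 x : 0 <= weight x. Proof. exact/ltW/weight_gt0. Qed.

Lemma weight_le x : weight x <= weight_bound. Proof. exact: heat_kernel_le. Qed.

Lemma norm_weight_le x : `|weight x| <= weight_bound.
Proof. by rewrite ger0_norm ?weight_ge0// weight_le. Qed.

Lemma continuous_weight : continuous weight.
Proof.
have cs (r : seq 'I_n) : continuous (fun x : 'rV[R]_n => \sum_(i <- r) x ord0 i ^+ 2).
  elim: r => [|i r ih].
    rewrite (_ : (fun _ => _) = fun _ => 0); first by move=> x; exact: cst_continuous.
    by apply/funext => x; rewrite big_nil.
  rewrite (_ : (fun _ => _) =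
      fun x => x ord0 i ^+ 2 + \sum_(j <- r) x ord0 j ^+ 2); last first.
    by apply/funext => x; rewrite big_cons.
  move=> x.
  have cc : {for x, continuous (fun x : 'rV[R]_n => x ord0 i)} by exact: coord_continuous.
  exact: (@continuousD R R^o _ _ _ x (continuousM cc cc) (ih x)).
have -> : weight = fun x => (4 * pi * 1) `^ (- (n%:R / 2)) *
    expR ((\sum_(i < n) x ord0 i ^+ 2) * - (4 * 1)^-1).
  by apply/funext => x; rewrite /weight /heat_kernel sqr_enorm mulrN.
move=> x.
have c0 := @cst_continuous 'rV[R]_n R (- (4 * 1)^-1) x.
have c1 := continuous_comp (continuousM (cs (index_enum 'I_n) x) c0) (@continuous_expR R _).
have c2 := @cst_continuous 'rV[R]_n R ((4 * pi * 1) `^ (- (n%:R / 2))) x.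
exact: (continuousM c2 c1).
Qed.

Lemma measurable_weight : measurable_fun setT weight.
Proof. exact: continuous_measurable_rV continuous_weight. Qed.

Lemma measurable_weight_powR q : measurable_fun setT (fun x => weight x `^ q).
Proof. exact: measurableT_comp (measurable_powR _) measurable_weight. Qed.

Lemma integrable_weight : leb.-integrable setT (EFin \o weight).
Proof.
have := integrable_heat_kernel (0 : 'rV[R]_n) ltr01.
by apply: eq_integrable => // x _ /=; rewrite subr0.
Qed.

Lemma integrable_weight_powR q : 1 < q ->
  leb.-integrable setT (EFin \o (fun x => weight x `^ q)).
Proof.
move=> q1; have q0 : 0 < q by exact: lt_trans q1.
have b (x : 'rV[R]_n) : `|weight x `^ (q - 1)| <= weight_bound `^ (q - 1).
  rewrite ger0_norm ?powR_ge0//; apply: ge0_ler_powR; rewrite ?nnegrE.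
  - by rewrite subr_ge0 ltW.
  - exact: weight_ge0.
  - exact: powR_ge0.
  - exact: weight_le.
have := integrable_mul_bounded integrable_weight (measurable_weight_powR _) b.
by apply: eq_integrable => // x _ /=; rewrite mulr_powRB1// weight_ge0.
Qed.

(* The weight makes the reference measure [weight `^ q] dx finite, so that
   continuous functions are dense. *)
Lemma test_measurable_le m1 m2 (p q C : R) (g : 'rV[R]_n -> R) K : 0 < p -> 1 < q ->
  p^-1 + q^-1 = 1 -> measurable_fun setT g -> (forall x, `|g x| <= K) ->
  (forall e, 0 < e -> exists2 t, 0 < t < e &
    (\int[leb]_x (`|heat_flow m1 m2 t x| `^ p)%:E <= C%:E)%E) ->
  \int[m1]_x (weight x * g x) - \int[m2]_x (weight x * g x) <=
   C / p + q^-1 * \int[leb]_x (weight x `^ q * `|g x| `^ q).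
Proof.
move=> p0 q1 pq mg gK H; have q0 : 0 < q by exact: lt_trans q1.
have K0 : 0 <= K by apply: le_trans (gK 0).
have iw m : m.-integrable setT (EFin \o weight).
  exact: bounded_integrable measurable_weight norm_weight_le.
have s1 := integral_seminorm_weight (iw m1) weight_ge0.
have s2 := integral_seminorm_weight (iw m2) weight_ge0.
have wq0 (x : 'rV[R]_n) : 0 <= weight x `^ q by exact: powR_ge0.
have iwq := integrable_weight_powR q1.
have s3 := integral_seminorm_weight iwq wq0.
pose N (f : 'rV[R]_n -> R) : R := \int[m1]_x (weight x * `|f x|) + \int[m2]_x (weight x * `|f x|) +
   \int[leb]_x (weight x `^ q * `|f x|).
have sN : integral_seminorm N.
  exact: (integral_seminormD (integral_seminormD s1 s2) s3).
(* Replacing [g] by [h] costs the two integrals of w |g - h| against [m1] and [m2], with factor 1,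
   and K^(q-1) times the Lebesgue integral of w^q |g - h|. Together they are at most [L] times the
   seminorm of g - h. *)
pose L := 1 + K `^ (q - 1).
have L0 : 0 < L by rewrite ltr_wpDr// powR_ge0.
apply/ler_addgt0Pr => e e0.
have [h [ch hK Nh]] := continuous_dense sN mg gK (divr_gt0 e0 L0).
have mh := continuous_measurable_rV ch.
have mgh : measurable_fun setT (fun x => g x - h x) by exact: measurable_funB.
have ghK x : `|g x - h x| <= K + K by rewrite (le_trans (ler_normB _ _))// lerD.
have mngh : measurable_fun setT (fun x => `|g x - h x|) by exact: measurableT_comp.
have nghK x : `| `|g x - h x| | <= K + K by rewrite normr_id.
have N0 (mu : {measure set 'rV[R]_n -> \bar R}) (v : 'rV[R]_n -> R) :
    (forall x, 0 <= v x) -> 0 <= \int[mu]_x (v x * `|g x - h x|).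
  by move=> v0; apply: Rintegral_ge0 => x _; rewrite mulr_ge0.
have D m : `|\int[m]_x (weight x * g x) - \int[m]_x (weight x * h x)| <=
    \int[m]_x (weight x * `|g x - h x|).
  have i1 := integrable_mul_bounded (iw m) mg gK.
  have i2 := integrable_mul_bounded (iw m) mh hK.
  rewrite -RintegralB//.
  apply: le_trans (le_normr_Rintegral _ _) _ => //.
    exact: (integrableB measurableT i1 i2).
  rewrite le_eqVlt; apply/orP; left; apply/eqP; apply: eq_Rintegral => x _.
  by rewrite -mulrBr normrM ger0_norm// weight_ge0.
pose phi x := weight x * h x.
have cphi : continuous phi.
  by move=> x; apply: continuousM; [exact: continuous_weight|exact: ch].
have phiK x : `|phi x| <= weight_bound * K.
  by rewrite normrM ler_pM// norm_weight_le.
have := test_continuous_le p0 q0 pq cphi phiK H.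
have mpow (f : 'rV[R]_n -> R) : measurable_fun setT f ->
    measurable_fun setT (fun x => `|f x| `^ q).
  move=> mf; apply: measurableT_comp (measurable_powR _) _.
  exact: measurableT_comp.
have bpow (f : 'rV[R]_n -> R) : (forall x, `|f x| <= K) ->
    forall x, `| `|f x| `^ q | <= K `^ q.
  move=> fK x; rewrite ger0_norm ?powR_ge0//.
  by apply: ge0_ler_powR; rewrite ?nnegrE ?(ltW q0).
have ih := integrable_mul_bounded iwq (mpow _ mh) (bpow _ hK).
have ig := integrable_mul_bounded iwq (mpow _ mg) (bpow _ gK).
have ingh := integrable_mul_bounded iwq mngh nghK.
have -> : (\int[leb]_x (`|phi x| `^ q)%:E)%E =
    ((\int[leb]_x (weight x `^ q * `|h x| `^ q))%R)%:E.
  rewrite EFin_Rintegral//; apply: eq_integral => x _.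
  by rewrite normrM powRM// ger0_norm// weight_ge0.
rewrite -EFinM -EFinD lee_fin => T.
have I : \int[leb]_x (weight x `^ q * `|h x| `^ q) <=
    \int[leb]_x (weight x `^ q * `|g x| `^ q) +
    q * K `^ (q - 1) * \int[leb]_x (weight x `^ q * `|g x - h x|).
  have inL := integrableZl measurableT (q * K `^ (q - 1)) ingh.
  rewrite -(RintegralZl _ measurableT ingh) -RintegralD//; apply: le_Rintegral => //.
    exact: (integrableD measurableT ig inL).
  move=> x _.
  have hx : 0 <= `|h x| <= K by rewrite normr_ge0 hK.
  have := ler_powR_lipschitz p0 q0 pq (normr_ge0 (g x)) hx.
  move=> /(ler_wpM2l (wq0 x)) /le_trans; apply.
  rewrite mulrDr lerD2l [leRHS]mulrCA; apply: ler_wpM2l => //.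
  apply: ler_wpM2l; first by rewrite mulr_ge0 ?powR_ge0// ltW.
  by rewrite distrC ler_dist_dist.
have : N (fun x => g x - h x) * L <= e by rewrite -ler_pdivlMr.
move: (D m1) (D m2) (N0 m1 _ weight_ge0) (N0 m2 _ weight_ge0) (N0 leb _ wq0) T I.
rewrite /N /L /phi.
set G1 := \int[m1]_x (weight x * g x); set G2 := \int[m2]_x (weight x * g x).
set H1 := \int[m1]_x (weight x * h x); set H2 := \int[m2]_x (weight x * h x).
set D1 := \int[m1]_x (weight x * `|_|); set D2 := \int[m2]_x (weight x * `|_|).
set D3 := \int[leb]_x (_ * `|g x - h x|).
set Gq := \int[leb]_x (_ * `|g x| `^ q); set Hq := \int[leb]_x (_ * `|h x| `^ q).
have k0 : 0 <= K `^ (q - 1) by exact: powR_ge0.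
move: k0; set k := K `^ (q - 1) => k0.
rewrite !ler_norml => /andP[a1 a2] /andP[b1 b2] d1 d2 d3 T I E.
have qV : 0 <= q^-1 by rewrite invr_ge0 ltW.
have := ler_wpM2l qV I.
have -> : q^-1 * (Gq + q * k * D3) = q^-1 * Gq + k * D3.
  by field; rewrite gt_eqF.
move=> I'.
have : 0 <= k * D1 by rewrite mulr_ge0.
have : 0 <= k * D2 by rewrite mulr_ge0.
have : (D1 + D2 + D3) * (1 + k) = D1 + D2 + D3 + k * D1 + k * D2 + k * D3 by ring.
lra.
Qed.

End test_functions.

(** * Absolute continuity *)

Section density.
Context d (T : measurableType d) (R : realType).

Lemma Rintegral_Radon_Nikodym (m : {finite_measure set T -> \bar R})
    (mu : {sigma_finite_measure set T -> \bar R}) : m `<< mu ->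
  exists f : T -> R, [/\ mu.-integrable setT (EFin \o f),
    forall A, measurable A -> m A = (\int[mu]_(x in A) (f x)%:E)%E &
    forall phi : T -> R, bounded_measurable phi ->
      \int[m]_x phi x = \int[mu]_x (f x * phi x)].
Proof.
move=> mmu; pose D := Radon_Nikodym (charge_of_finite_measure m) mu.
have Dfin x : D x \is a fin_num by exact: Radon_Nikodym_fin_num.
have DE x : (fine (D x))%:E = D x by rewrite fineK.
have iD : mu.-integrable setT (EFin \o (fine \o D)).
  have : mu.-integrable setT D by exact: Radon_Nikodym_integrable.
  by apply: eq_integrable => // x _; rewrite /= DE.
exists (fine \o D); split => //.
  move=> A mA; transitivity (\int[mu]_(x in A) D x)%E; last first.
    by apply: eq_integral => x _; rewrite /= DE.
  exact: (@Radon_Nikodym_integral _ _ _ (charge_of_finite_measure m) mu A mmu mA).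
move=> phi [mphi [K phiK]]; congr fine.
rewrite -(Radon_Nikodym_change_of_variables mmu)//; last first.
  exact: bounded_integrable phiK.
by apply: eq_integral => x _; rewrite /= mulrC EFinM DE.
Qed.

(** Both Jordan parts inherit the domination, so the density is the difference of their
    Radon-Nikodym derivatives. *)
Lemma charge_integral_density (nu : {charge set T -> \bar R})
    (mu : {sigma_finite_measure set T -> \bar R}) : nu `<< mu ->
  exists f : T -> R, has_density nu mu f /\
    forall phi, bounded_measurable phi ->
      charge_integral nu phi = \int[mu]_x (f x * phi x).
Proof.
move=> numu; have PN := svalP (hahn_pair nu).
have [f [fi fA fphi]] := Rintegral_Radon_Nikodym (jordan_pos_dominates PN numu).
have [g [gi gA gphi]] := Rintegral_Radon_Nikodym (jordan_neg_dominates PN numu).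
exists (fun x => f x - g x); split.
  split; first exact: (integrableB measurableT fi gi).
  move=> A mA; rewrite [LHS](jordan_decomp PN mA).
  rewrite integralB_EFin//; [|exact: (integrableS measurableT)..].
  by rewrite -fA// -gA//= /cadd/= cscaleN1.
move=> phi bphi; have [mphi [K phiK]] := bphi.
transitivity (\int[mu]_x (f x * phi x) - \int[mu]_x (g x * phi x)).
  by congr (_ - _); [exact: fphi|exact: gphi].
rewrite -RintegralB//; last 2 first.
- exact: integrable_mul_bounded fi mphi phiK.
- exact: integrable_mul_bounded gi mphi phiK.
by apply: eq_Rintegral => x _; rewrite mulrBl.
Qed.

Lemma null_of_integral_eq0 (m : {measure set T -> \bar R}) (w : T -> R) B :
  measurable B -> measurable_fun setT w -> (forall x, 0 < w x) ->
  (\int[m]_(x in B) (w x)%:E = 0)%E -> m B = 0%E.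
Proof.
move=> mB mw w0 iB.
have mwB : measurable_fun B (EFin \o w).
  by apply/measurable_EFinP; exact: measurable_funTS.
have /(ae_eq_integral_abs _ mB mwB) : (\int[m]_(x in B) `|(EFin \o w) x| = 0)%E.
  by rewrite -iB; apply: eq_integral => x _; rewrite /= ger0_norm// ltW.
move=> /negligibleS H; apply: measure_negligible => //.
apply: H => x Bx /= /(_ Bx) [wx].
by have := w0 x; rewrite wx ltxx.
Qed.

End density.

Section absolute_continuity.
Context (R : realType) (n : nat).
Local Notation leb := (lebesgue_rV R n).
Variable nu : {charge set 'rV[R]_n -> \bar R}.
Local Notation PN := (svalP (hahn_pair nu)).
Local Notation jp := (jordan_pos PN).
Local Notation jn := (jordan_neg PN).
Variables (p q C : R).
Hypotheses (p0 : 0 < p) (q1 : 1 < q) (pq : p^-1 + q^-1 = 1).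
Hypothesis FC : forall e, 0 < e -> exists2 t, 0 < t < e &
  (\int[leb]_x (`|heat_flow jp jn t x| `^ p)%:E <= C%:E)%E.

Let q0 : 0 < q. Proof. exact: lt_trans q1. Qed.

Let Rintegral_weight_indic (m : {measure set 'rV[R]_n -> \bar R}) (v : 'rV[R]_n -> R) B :
  \int[m]_x (v x * \1_B x) = \int[m]_(x in B) v x.
Proof.
rewrite [RHS]Rintegral_mkcond; apply: eq_Rintegral => x _.
by rewrite /patch indicE; case: ifPn => _; rewrite ?mulr1 ?mulr0.
Qed.

(* Multiples of the indicator of a Lebesgue-null set cost nothing on the
   right-hand side of [test_measurable_le]. *)
Let eq_jordan_null B : measurable B -> leb B = 0%E ->
  \int[jp]_(x in B) weight x = \int[jn]_(x in B) weight x.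
Proof.
move=> mB B0; apply/eqP; rewrite -subr_eq0; apply/eqP.
set D := _ - _.
have H c : c * D <= C / p.
  have mg : measurable_fun setT (fun x => c * \1_B x).
    by apply: measurable_funM => //; exact: measurable_indic.
  have gK x : `|c * \1_B x| <= `|c|.
    rewrite normrM ler_piMr// indicE.
    by case: (_ \in _); rewrite ?normr0 ?normr1.
  have := test_measurable_le p0 q1 pq mg gK FC.
  have E (m : {finite_measure set 'rV[R]_n -> \bar R}) :
      \int[m]_x (weight x * (c * \1_B x)) = c * \int[m]_(x in B) weight x.
    rewrite -[X in c * X]Rintegral_weight_indic -RintegralZl//.
      by apply: eq_Rintegral => x _; ring.
    have iw := bounded_integrable m (@measurable_weight R n) (@norm_weight_le R n).
    apply: (integrable_mul_bounded (K := 1)) iw _ _ => [|x].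
      exact: measurable_indic.
    by rewrite indicE; case: (_ \in _); rewrite ?normr0 ?normr1.
  rewrite !E.
  have -> : \int[leb]_x (weight x `^ q * `|c * \1_B x| `^ q) = 0.
    transitivity (\int[leb]_x (weight x `^ q * `|c| `^ q * \1_B x)).
      apply: eq_Rintegral => x _; rewrite -mulrA; congr (_ * _).
      rewrite indicE; case: (_ \in _); rewrite ?mulr1 ?mulr0//.
      by rewrite normr0 powR0// gt_eqF.
    rewrite (Rintegral_weight_indic _ (fun x => weight x `^ q * `|c| `^ q)).
    rewrite /Rintegral null_set_integral//; apply: measurable_funTS.
    apply/measurable_EFinP/measurable_funM => //.
    exact: measurable_weight_powR.
  by rewrite mulr0 addr0 -mulrBr.
(* For nonzero [D] of either sign this multiple makes c D equal to C/p + 1, which exceeds the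
   bound. *)
apply: contrapT => /eqP D0; have := H ((C / p + 1) / D).
by rewrite divfK//; lra.
Qed.

(** The two Jordan parts have equal weighted mass on every Lebesgue-null set, yet they live on
    disjoint sets of the Hahn decomposition. On the positive half of a null set the negative part
    vanishes, hence so does the positive part; the other half is symmetric. *)
Lemma heat_flow_bounded_dominates : nu `<< leb.
Proof.
have [[mP pP] [mN nN] PNT PN0] := PN.
set P := (sval (hahn_pair nu)).1; set N := (sval (hahn_pair nu)).2.
apply/null_content_dominatesP => A mA A0.
have mAP : measurable (A `&` P) by exact: measurableI.
have mAN : measurable (A `&` N) by exact: measurableI.
have null B : measurable B -> B `<=` A -> leb B = 0%E.
  by move=> mB BA; apply: (subset_measure0 mB mA BA A0).
have jpE B : measurable B -> jp B = nu (B `&` P).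
  by move=> mB; rewrite jordan_posE cjordan_posE /crestr0 mem_set.
have jnE B : measurable B -> jn B = (- nu (B `&` N))%E.
  by move=> mB; rewrite jordan_negE cjordan_negE /crestr0 mem_set.
have mw B (m : {measure set 'rV[R]_n -> \bar R}) : m B = 0%E -> measurable B ->
    \int[m]_(x in B) weight x = 0.
  move=> mB0 mB; rewrite /Rintegral null_set_integral//; apply: measurable_funTS.
  by apply/measurable_EFinP; exact: measurable_weight.
have fin B (m : {finite_measure set 'rV[R]_n -> \bar R}) : measurable B ->
    \int[m]_(x in B) weight x = 0 -> m B = 0%E.
  move=> mB; have iw := bounded_integrable m (@measurable_weight R n) (@norm_weight_le R n).
  move=> H; apply: (null_of_integral_eq0 mB (@measurable_weight R n)).
    exact: weight_gt0.
  have /fineK <- : (\int[m]_(x in B) (weight x)%:E)%E \is a fin_num.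
    by apply: integrable_fin_num => //; exact: (integrableS measurableT).
  by congr EFin.
have jnAP : jn (A `&` P) = 0%E.
  by rewrite jnE// -setIA PN0 setI0 charge0 oppe0.
have jpAN : jp (A `&` N) = 0%E.
  by rewrite jpE// -setIA (setIC N) PN0 setI0 charge0.
have h1 : jp (A `&` P) = 0%E.
  apply: fin => //; rewrite eq_jordan_null//; last by apply: null => // x [].
  exact: mw.
have h2 : jn (A `&` N) = 0%E.
  apply: fin => //; rewrite -eq_jordan_null//; last by apply: null => // x [].
  exact: mw.
move: h1 h2; rewrite jpE// jnE// -!setIA !setIid => h1 /eqP.
rewrite oppe_eq0 => /eqP h2.
transitivity (jp A - jn A)%E.
  by rewrite [LHS](jordan_decomp PN mA) /cadd/= cscaleN1.
by rewrite jpE// jnE// h1 h2 !oppe0 adde0.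
Qed.

End absolute_continuity.

(** * The density is in L^p *)

Section lp_bound.
Context (R : realType) (n : nat).
Local Notation leb := (lebesgue_rV R n).
Variable nu : {charge set 'rV[R]_n -> \bar R}.
Local Notation jp := (jordan_pos (svalP (hahn_pair nu))).
Local Notation jn := (jordan_neg (svalP (hahn_pair nu))).
Variables (p q : R).
Hypotheses (p1 : 1 < p) (q1 : 1 < q) (pq : p^-1 + q^-1 = 1).
Variable f : 'rV[R]_n -> R.
Hypothesis fi : leb.-integrable setT (EFin \o f).
Hypothesis fnu : forall phi, bounded_measurable phi ->
  charge_integral nu phi = \int[leb]_x (f x * phi x).

Let p0 : 0 < p. Proof. exact: lt_trans p1. Qed.
Let q0 : 0 < q. Proof. exact: lt_trans q1. Qed.
Let mf : measurable_fun setT f.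
Proof. by apply/measurable_EFinP; exact: measurable_int fi. Qed.
Let mfp (r : R) : measurable_fun setT (fun x => `|f x| `^ r).
Proof. by apply: measurableT_comp (measurable_powR _) _; exact: measurableT_comp. Qed.

(* Test with [sgn f |f|^(p-1)] on the set where [|f| <= k] and the weight is at
   least [1/(k+1)], then let [k] tend to infinity. *)
Lemma integral_powR_density_le (C : R) :
  (forall e, 0 < e -> exists2 t, 0 < t < e &
    (\int[leb]_x (`|heat_flow jp jn t x| `^ p)%:E <= C%:E)%E) ->
  (\int[leb]_x (`|f x| `^ p)%:E <= C%:E)%E.
Proof.
move=> FC.
pose w := @weight R n.
have w0 x : 0 < w x by exact: weight_gt0.
have mw : measurable_fun setT w by exact: measurable_weight.
pose E (k : nat) : set 'rV[R]_n := [set x | `|f x| <= k%:R] `&` [set x | k.+1%:R^-1 <= w x].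
have mE k : measurable (E k).
  apply: measurableI.
    rewrite -[X in measurable X]setTI.
    have -> : [set x | `|f x| <= k%:R] = (fun x => `|f x|) @^-1` `]-oo, k%:R]%classic.
      by apply/seteqP; split=> x /=; rewrite in_itv.
    have mnf : measurable_fun setT (fun x => `|f x|) by exact: measurableT_comp.
    exact: (mnf measurableT).
  rewrite -[X in measurable X]setTI.
  have -> : [set x | k.+1%:R^-1 <= w x] = w @^-1` `[k.+1%:R^-1, +oo[%classic.
    by apply/seteqP; split=> x /=; rewrite in_itv/= andbT.
  exact: (mw measurableT).
have ndE : nondecreasing_seq E.
  move=> i j ij; apply/subsetPset => x [/= fxi wxi]; split => /=.
    by apply: le_trans fxi _; rewrite ler_nat.
  by apply: le_trans wxi; rewrite lef_pV2 ?posrE// ler_nat.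
have UE : \bigcup_k E k = setT.
  apply/seteqP; split => // x _.
  have [i ix] : exists i : nat, `|f x| <= i%:R.
    by exists (Num.bound `|f x|); exact/ltW/archi_boundP.
  have [j jx] : exists j : nat, (w x)^-1 <= j%:R.
    by exists (Num.bound (w x)^-1); apply/ltW/archi_boundP; rewrite invr_ge0 ltW.
  exists (maxn i j) => //; split => /=.
    by apply: le_trans ix _; rewrite ler_nat leq_maxl.
  rewrite invf_ple ?posrE//; apply: le_trans jx _; rewrite ler_nat.
  by rewrite (leq_trans (leq_maxr i j)).
have bound k : (\int[leb]_(x in E k) (`|f x| `^ p)%:E <= C%:E)%E.
  (* f |f|^(p-2) is sgn f |f|^(p-1); where [f] vanishes the first factor gives 0, even if the
     exponent p - 2 is negative. *)
  pose s x := f x * `|f x| `^ (p - 1 - 1) * \1_(E k) x.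
  (* Dividing by the weight cancels the one built into [test_measurable_le]; the lower bound on the
     weight in [E k] keeps the quotient bounded. *)
  pose g x := s x * (w x)^-1.
  have p1' : 0 < p - 1 by rewrite subr_gt0.
  have ms : measurable_fun setT s.
    apply: measurable_funM; last exact: measurable_indic.
    by apply: measurable_funM; last exact: mfp.
  have sE x : E k x -> `|s x| = `|f x| `^ (p - 1).
    move=> Ex; rewrite /s indicE mem_set// mulr1 normrM.
    by rewrite [X in _ * X]ger0_norm ?powR_ge0// mulr_powRB1.
  have sN x : ~ E k x -> s x = 0.
    by move=> Ex; rewrite /s indicE memNset// mulr0.
  have sK x : `|s x| <= k%:R `^ (p - 1).
    have [Ex|Ex] := pselect (E k x); last by rewrite sN// normr0 powR_ge0.
    rewrite sE//; apply: ge0_ler_powR; rewrite ?nnegrE ?(ltW p1')//.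
    by case: Ex.
  have mg : measurable_fun setT g.
    apply: measurable_funM => //.
    rewrite (_ : (fun x => (w x)^-1) = (fun x => w x `^ (-1))).
      exact: measurableT_comp (measurable_powR _) mw.
    by apply/funext => x; rewrite powR_inv1// ltW.
  have gK x : `|g x| <= k%:R `^ (p - 1) * k.+1%:R.
    have [Ex|Ex] := pselect (E k x); last first.
      by rewrite /g sN// mul0r normr0 mulr_ge0// powR_ge0.
    rewrite normrM ler_pM//.
    rewrite ger0_norm ?invr_ge0 ?(ltW (w0 x))// invf_ple ?posrE//.
    by case: Ex.
  have := test_measurable_le p0 q1 pq mg gK FC.
  have wg x : weight x * g x = s x.
    by rewrite /g mulrCA -/(w x) mulfV ?mulr1// gt_eqF.
  have -> : \int[jp]_x (weight x * g x) = \int[jp]_x s x.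
    by apply: eq_Rintegral => x _; exact: wg.
  have -> : \int[jn]_x (weight x * g x) = \int[jn]_x s x.
    by apply: eq_Rintegral => x _; exact: wg.
  have bs : bounded_measurable s by split => //; exists (k%:R `^ (p - 1)).
  have -> : \int[jp]_x s x - \int[jn]_x s x = charge_integral nu s by [].
  rewrite (fnu bs).
  have fs x : f x * s x = `|f x| `^ p * \1_(E k) x.
    rewrite /s !mulrA; congr (_ * _).
    by rewrite -expr2 -real_normK ?num_real// expr2 -mulrA !mulr_powRB1.
  have ifs := integrable_mul_bounded fi ms sK.
  have -> : \int[leb]_x (weight x `^ q * `|g x| `^ q) = \int[leb]_x (f x * s x).
    apply: eq_Rintegral => x _; rewrite -powRM//; last exact: weight_ge0.
    rewrite -[X in (X * _) `^ q]ger0_norm; last exact: weight_ge0.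
    rewrite -normrM wg fs.
    have [Ex|Ex] := pselect (E k x); last first.
      by rewrite sN// normr0 powR0 ?gt_eqF// indicE memNset// mulr0.
    by rewrite indicE mem_set// mulr1 sE// -powRrM conjugate_exponent.
  (* Both sides now carry the same finite integral, as |s|^q = |f|^p = f s on [E k]. From I <= C/p +
     I/q follows I <= C. *)
  set I := \int[leb]_x (f x * s x) => HI.
  have IC : I <= C.
    have h : p^-1 * I <= p^-1 * C.
      rewrite [leRHS]mulrC; have -> : p^-1 * I = I - q^-1 * I.
        by rewrite -[X in X - _]mul1r -pq; ring.
      by lra.
    by rewrite ler_pM2l ?invr_gt0 in h.
  apply: (@le_trans _ _ I%:E); last by rewrite lee_fin.
  rewrite [leLHS]integral_mkcond EFin_Rintegral//.
  rewrite le_eqVlt; apply/orP; left; apply/eqP; apply: eq_integral => x _.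
  by rewrite fs /patch indicE; case: ifPn => _; rewrite ?mulr1 ?mulr0.
have mEf k : measurable_fun (E k) (fun x => (`|f x| `^ p)%:E).
  by apply: measurable_funTS; apply/measurable_EFinP; exact: mfp.
have f0 k x : E k x -> (0 <= (`|f x| `^ p)%:E)%E.
  by move=> _; rewrite lee_fin powR_ge0.
have cv := ge0_nondecreasing_set_cvg_integral (mu := leb) ndE mE mEf f0.
rewrite -UE -(cvg_lim _ cv)//; apply: lime_le; last exact: nearW.
by apply/cvg_ex; eexists; exact: cv.
Qed.

(* Jensen's inequality for the probability density [heat_kernel t (x - _)],
   obtained from Young's inequality with the constant [a^(p-1)]. *)
Lemma powR_heat_flow_le t x : 0 < t ->
  ((`|\int[leb]_y (f y * heat_kernel t (x - y))| `^ p)%:E <=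
   \int[leb]_y (`|f y| `^ p * heat_kernel t (x - y))%:E)%E.
Proof.
move=> t0.
have mk := measurable_heat_kernelBr t x.
have k0 (y : 'rV[R]_n) : 0 <= heat_kernel t (x - y) by exact: heat_kernel_ge0.
have kK y : `|heat_kernel t (x - y)| <= (4 * pi * t) `^ (- (n%:R / 2)).
  by rewrite ger0_norm//; exact: heat_kernel_le.
have ik : leb.-integrable setT (EFin \o (fun y => heat_kernel t (x - y))).
  have := integrable_heat_kernel x t0; apply: eq_integrable => // y _ /=.
  by rewrite heat_kernelB.
have k1 : \int[leb]_y heat_kernel t (x - y) = 1.
  rewrite -(Rintegral_heat_kernel x t0); apply: eq_Rintegral => y _.
  exact: heat_kernelB.
have ifk := integrable_mul_bounded fi mk kK.
have inf := integrable_norm fi.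
have infk := integrable_mul_bounded inf mk kK.
set a := \int[leb]_y (`|f y| * heat_kernel t (x - y)).
have a0 : 0 <= a by apply: Rintegral_ge0 => y _; rewrite mulr_ge0.
apply: (@le_trans _ _ (a `^ p)%:E).
  rewrite lee_fin; apply: ge0_ler_powR; rewrite ?nnegrE ?(ltW p0)//.
  apply: le_trans (le_normr_Rintegral _ ifk) _ => //.
  rewrite le_eqVlt; apply/orP; left; apply/eqP; apply: eq_Rintegral => y _.
  by rewrite normrM [X in _ * X]ger0_norm.
set B := (\int[leb]_y _)%E.
have B0 : (0 <= B)%E.
  by apply: integral_ge0 => y _; rewrite lee_fin mulr_ge0// powR_ge0.
have [->|Boo] := eqVneq B +oo%E; first exact: leey.
have Bfin : B \is a fin_num by rewrite ge0_fin_numE// lt_neqAle Boo leey.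
have iB : leb.-integrable setT (EFin \o (fun y => `|f y| `^ p * heat_kernel t (x - y))).
  apply: integrable_ge0_lty.
  - by apply: measurable_funM => //; exact: mfp.
  - by move=> y; rewrite mulr_ge0// powR_ge0.
  - by rewrite -/B lt_neqAle Boo leey.
have BE : B = (\int[leb]_y (`|f y| `^ p * heat_kernel t (x - y)))%R%:E.
  by rewrite EFin_Rintegral.
rewrite BE lee_fin; set b := \int[leb]_y _.
pose c := a `^ (p - 1).
have ca : a `^ p = \int[leb]_y (c * (`|f y| * heat_kernel t (x - y))).
  by rewrite (RintegralZl _ measurableT infk) -/a mulrC /c mulr_powRB1.
have cq : c `^ q = a `^ p by rewrite /c -powRrM conjugate_exponent.
have : a `^ p <= p^-1 * b + q^-1 * a `^ p.
  rewrite [leLHS]ca.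
  have i1 := integrableZl measurableT p^-1 iB.
  have i2 := integrableZl measurableT (q^-1 * a `^ p) ik.
  have -> : q^-1 * a `^ p = \int[leb]_y (q^-1 * a `^ p * heat_kernel t (x - y)).
    by rewrite (RintegralZl _ measurableT ik) k1 mulr1.
  rewrite -(RintegralZl _ measurableT iB) -RintegralD//.
  apply: le_Rintegral => //.
  - exact: (integrableZl measurableT c infk).
  - exact: (integrableD measurableT i1 i2).
  - move=> y _.
    rewrite [leLHS](_ : _ = `|f y| * c * heat_kernel t (x - y)); last by rewrite /=; ring.
    rewrite [leRHS](_ : _ = (p^-1 * `|f y| `^ p + q^-1 * a `^ p) *
      heat_kernel t (x - y)); last by rewrite /=; ring.
    rewrite -cq; apply: ler_wpM2r => //.
    have := @conjugate_powR R `|f y| c p q (normr_ge0 _) (powR_ge0 _ _) p0 q0 pq.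
    by rewrite ![_ / _]mulrC.
move=> H; have : p^-1 * a `^ p <= p^-1 * b.
  have -> : p^-1 * a `^ p = a `^ p - q^-1 * a `^ p.
    by rewrite -[X in X - _]mul1r -pq; ring.
  by lra.
by rewrite ler_pM2l// invr_gt0.
Qed.

(** The pointwise Jensen bound is integrated in [x]; after Tonelli the kernel contributes mass one
    for each [y]. *)
Lemma integral_powR_heat_flow_le t : 0 < t ->
  (\int[leb]_x (`|heat_flow jp jn t x| `^ p)%:E <=
   \int[leb]_x (`|f x| `^ p)%:E)%E.
Proof.
move=> t0.
have uE x : heat_flow jp jn t x = \int[leb]_y (f y * heat_kernel t (x - y)).
  rewrite -fnu//; split; first exact: measurable_heat_kernelBr.
  exists ((4 * pi * t) `^ (- (n%:R / 2))) => y.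
  by rewrite ger0_norm ?heat_kernel_ge0//; exact: heat_kernel_le.
apply: (@le_trans _ _ (\int[leb]_x \int[leb]_y
    (`|f y| `^ p * heat_kernel t (x - y))%:E)%E).
  apply: ge0_le_integral_nonmeasurable => x _; first by rewrite lee_fin powR_ge0.
  by rewrite uE; exact: powR_heat_flow_le.
pose h (z : 'rV[R]_n * 'rV[R]_n) := (`|f z.2| `^ p * heat_kernel t (z.1 - z.2))%:E.
have mh : measurable_fun setT h.
  apply/measurable_EFinP/measurable_funM; last exact: measurable_heat_kernelB.
  exact: measurableT_comp (mfp p) measurable_snd.
have h0 z : (0 <= h z)%E by rewrite lee_fin mulr_ge0 ?powR_ge0 ?heat_kernel_ge0.
rewrite [leLHS](fubini_tonelli (m1 := leb) (m2 := leb) h mh h0).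
rewrite le_eqVlt; apply/orP; left; apply/eqP; apply: eq_integral => y _ /=.
rewrite /h/=; under eq_integral do rewrite EFinM.
rewrite ge0_integralZl_EFin ?powR_ge0//.
- by rewrite integral_heat_kernel// mule1.
- by move=> x _; rewrite lee_fin heat_kernel_ge0.
- by apply/measurable_EFinP; exact: measurable_heat_kernelBl.
Qed.

End lp_bound.

(** * Negative Sobolev norms *)

Section negative_sobolev.
Context (R : realType) (n : nat).
Local Notation leb := (lebesgue_rV R n).
Variable nu : {charge set 'rV[R]_n -> \bar R}.
Local Notation jp := (jordan_pos (svalP (hahn_pair nu))).
Local Notation jn := (jordan_neg (svalP (hahn_pair nu))).
Implicit Types (p alpha : R) (f : 'rV[R]_n -> R).

(** Since [neg_sobolev_norm] is +oo outside the space, the limit requires membership for all small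
    [alpha]. The functional g |-> int f g is bounded on L^q by Hoelder's inequality, and the Sobolev
    norm dominates the L^q norm. *)
Lemma neg_sobolev_Lp p alpha f : 1 < p -> f \in Lfun leb p%:E ->
  (forall phi, bounded_measurable phi ->
    charge_integral nu phi = \int[leb]_x (f x * phi x)) ->
  neg_sobolev alpha p (charge_integral nu).
Proof.
move=> p1 fLp fnu; have p0 : 0 < p by exact: lt_trans p1.
split; first exact: charge_tempered.
set q := (1 - p^-1)^-1.
have pV1 : p^-1 < 1 by rewrite invf_lt1.
have q0 : 0 < q by rewrite invr_gt0 subr_gt0.
have pq : p^-1 + q^-1 = 1 by rewrite /q invrK; ring.
move: fLp; rewrite inE/= => /andP[]; rewrite !inE/= => mf fp.
have Nfin g : g \in Lfun leb q%:E -> measurable_fun setT g /\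
    ('N[leb]_q%:E[EFin \o g] < +oo)%E.
  by rewrite inE/= => /andP[]; rewrite !inE.
have hold g : g \in Lfun leb q%:E ->
    (\int[leb]_x (`|f x * g x|)%:E <= 'N[leb]_p%:E[EFin \o f] * 'N[leb]_q%:E[EFin \o g])%E.
  by move=> /Nfin[mg _]; have := hoelder leb mf mg p0 q0 pq; rewrite Lnorm1.
have ifg g : g \in Lfun leb q%:E -> leb.-integrable setT (EFin \o (fun x => f x * g x)).
  move=> gq; have [mg gy] := Nfin _ gq; apply/integrableP; split.
    by apply/measurable_EFinP; exact: measurable_funM.
  apply: le_lt_trans (hold _ gq) _.
  by rewrite lte_mul_pinfty// ?Lnorm_ge0// ge0_fin_numE// Lnorm_ge0.
exists (fun g => \int[leb]_x (f x * g x)); last first.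
  move=> phi Sphi; apply: fnu; split.
    by apply: continuous_measurable_rV; have [/(_ [::])[]] := Sphi.
  by exists (schwartz_norm 0 phi); exact: schwartz_bounded.
split.
  move=> a g h [gq _] [hq _]; have ig := ifg _ gq; have ih := ifg _ hq.
  rewrite -RintegralZl// -RintegralD//.
    by apply: eq_Rintegral => x _; ring.
  exact: (integrableZl measurableT a ig).
exists (fine ('N[leb]_p%:E[EFin \o f]))%E => g [gq _].
have fpfin : ('N[leb]_p%:E[EFin \o f])%E \is a fin_num.
  by rewrite ge0_fin_numE// Lnorm_ge0.
rewrite fineK//.
apply: (@le_trans _ _ (\int[leb]_x (`|f x * g x|)%:E)%E).
  have := le_normr_Rintegral measurableT (ifg _ gq).
  rewrite -lee_fin => /le_trans; apply.
  by rewrite EFin_Rintegral//; exact: integrable_norm (ifg _ gq).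
apply: le_trans (hold _ gq) _; apply: lee_wpmul2l; first exact: Lnorm_ge0.
rewrite /sobolev_norm.
have Ng0 : (0 <= 'N[leb]_q%:E[EFin \o g])%E by exact: Lnorm_ge0.
have G0 : (0 <= gagliardo alpha q g)%E.
  apply: integral_ge0 => x _; apply: integral_ge0 => y _.
  by rewrite lee_fin divr_ge0// powR_ge0.
rewrite [leLHS](_ : _ = ('N[leb]_q%:E[EFin \o g] `^ q) `^ q^-1)%E; last first.
  by rewrite -poweRrM mulfV ?poweRe1// gt_eqF.
apply: gt0_ler_poweR; rewrite ?in_itv/= ?leey ?andbT.
- by rewrite invr_ge0 ltW.
- exact: poweR_ge0.
- by rewrite adde_ge0// poweR_ge0.
- by rewrite leeDl.
Qed.

(** This is the F(t) of the overview, written with the Jordan parts of [nu]. *)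
Definition heat_energy p t : \bar R :=
  (\int[leb]_x (`|heat_flow jp jn t x| `^ p)%:E)%E.

Lemma heat_energy_ge0 p t : (0 <= heat_energy p t)%E.
Proof. by apply: integral_ge0 => x _; rewrite lee_fin powR_ge0. Qed.

Lemma neg_sobolev_norm_powR p alpha : 0 < p ->
  neg_sobolev alpha p (charge_integral nu) ->
  (neg_sobolev_norm alpha p (charge_integral nu) `^ p =
   \int[@lebesgue_measure R]_(t in `]0%R, 1%R[)
     ((t `^ (alpha * p / 2 - 1))%:E * heat_energy p t))%E.
Proof.
move=> p0 Hs; rewrite /neg_sobolev_norm asboolT//.
rewrite -poweRrM mulVf ?gt_eqF// poweRe1; last first.
  apply: integral_ge0 => t; rewrite /= in_itv/= => /andP[t0 _].
  by rewrite mule_ge0 ?poweR_ge0// lee_fin invr_ge0 ltW.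
apply: eq_integral => t; rewrite inE/= in_itv/= => /andP[t0 _].
rewrite poweR_weight//; last exact: Lnorm_ge0.
(* Unfolding [charge_integral] turns the convolution with the kernel into [heat_flow] of the Jordan
   parts. *)
congr (_ * _)%E; rewrite poweR_Lnorm ?gt_eqF//.
Qed.

(** Used in contrapositive form: a finite value at some alpha > 0 certifies membership there, and
    with it the integral formula for the norm. *)
Lemma neg_sobolev_norm_notin p alpha : 0 < p -> 0 < alpha ->
  ~ neg_sobolev alpha p (charge_integral nu) ->
  (alpha%:E * neg_sobolev_norm alpha p (charge_integral nu) `^ p = +oo)%E.
Proof.
move=> p0 a0 Hs; rewrite /neg_sobolev_norm asboolF// poweRyr ?gt_eqF//.
by rewrite gt0_muley// lte_fin.
Qed.

End negative_sobolev.

(** * Lower limits at 0 from the right *)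

(** The lower limit is a supremum of infima over neighborhoods. A real [M] strictly above it exceeds
    the infimum over each interval (0, e), so some value there is below [M]. *)
Lemma limf_einf_at_right_frequently (R : realType) (h : R -> \bar R) :
  (limf_einf h 0^'+ < +oo)%E ->
  exists M : R, 0 <= M /\
    forall e, 0 < e -> exists2 a, 0 < a < e & (h a <= M%:E)%E.
Proof.
rewrite limf_einfE => hoo.
have [M M0 hM] : exists2 M : R, 0 <= M &
    (ereal_sup [set ereal_inf (h @` V) | V in 0^'+] < M%:E)%E.
  move: hoo; case: ereal_sup => [r _|//|_].
    exists (`|r| + 1); first by rewrite addr_ge0.
    by rewrite lte_fin ltr_pwDr// ler_norm.
  by exists 0 => //; exact: ltNyr.
exists M; split => // e e0.
have : (ereal_inf (h @` [set a | (0 < a < e)%R]) < M%:E)%E.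
  apply: le_lt_trans hM; apply: ereal_sup_ubound.
  exists [set a | (0 < a < e)%R] => //.
  near=> a; apply/andP; split; near: a; [exact: nbhs_right_gt|exact: nbhs_right_lt].
move=> /ereal_inf_lt[_ [a /= ae <-] haM].
by exists a => //; exact: ltW.
Unshelve. all: by end_near. Qed.

Unset Implicit Arguments.

Theorem corollary4p1 (R : realType) (n : nat) (p : R)
    (nu : {charge set 'rV[R]_n -> \bar R}) :
  (0 < n)%N -> 1 < p ->
  (exists2 alpha : R, 0 < alpha < 1 &
     neg_sobolev alpha p (charge_integral nu)) ->
  (limf_einf (fun alpha : R =>
     alpha%:E * neg_sobolev_norm alpha p (charge_integral nu) `^ p) 0^'+
   < +oo)%E ->
  nu `<< lebesgue_rV R n /\
  exists f : 'rV[R]_n -> R,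
    [/\ f \in Lfun (lebesgue_rV R n) p%:E,
        has_density nu (lebesgue_rV R n) f &
        (alpha%:E * neg_sobolev_norm alpha p (charge_integral nu) `^ p)%E
          @[alpha --> 0^'+] -->
        ((2 / p)%:E * 'N[lebesgue_rV R n]_p%:E[EFin \o f] `^ p)%E].
Proof.
move=> _ p1 _ Hinf; have p0 : 0 < p by exact: lt_trans p1.
pose q := (1 - p^-1)^-1.
have pV1 : p^-1 < 1 by rewrite invf_lt1.
have pV0 : 0 < p^-1 by rewrite invr_gt0.
have q1 : 1 < q by rewrite invf_gt1 ?subr_gt0//; lra.
have pq : p^-1 + q^-1 = 1 by rewrite /q invrK; ring.
have F0 := heat_energy_ge0 nu p.
have [M [M0 HM]] := limf_einf_at_right_frequently Hinf.
have [|C [C0 FC]] := frequently_le_integral_powR p0 M0 F0.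
  move=> e /HM[a ae aM]; exists a => //; have /andP[a0 _] := ae.
  (* At such an [a] the value is at most [M], which excludes the convention +oo. *)
  have Hs : neg_sobolev a p (charge_integral nu).
    apply: contrapT => Hs; move: aM.
    by rewrite neg_sobolev_norm_notin// leye_eq.
  by rewrite -neg_sobolev_norm_powR.
have nuleb := heat_flow_bounded_dominates p0 q1 pq FC.
split=> //.
have [f [df fnu]] := charge_integral_density nuleb.
have fi := df.1.
have fC := integral_powR_density_le p1 q1 pq fi fnu FC.
have Nf : ('N[lebesgue_rV R n]_p%:E[EFin \o f] `^ p =
    \int[lebesgue_rV R n]_x (`|f x| `^ p)%:E)%E by rewrite poweR_Lnorm ?gt_eqF.
have If0 : (0 <= \int[lebesgue_rV R n]_x (`|f x| `^ p)%:E)%E.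
  by apply: integral_ge0 => x _; rewrite lee_fin powR_ge0.
have Iffin : (\int[lebesgue_rV R n]_x (`|f x| `^ p)%:E)%E \is a fin_num.
  by rewrite ge0_fin_numE// (le_lt_trans fC)// ltry.
have fLp : f \in Lfun (lebesgue_rV R n) p%:E.
  rewrite inE/=; apply/andP; split; rewrite inE/=.
    by apply/measurable_EFinP; exact: measurable_int fi.
  by apply: (@lty_poweRy _ _ p); rewrite ?gt_eqF// Nf (le_lt_trans fC)// ltry.
exists f; split => //.
rewrite Nf -(fineK Iffin) -EFinM; set L := fine _.
have L0 : 0 <= L by exact: fine_ge0.
have FL t : 0 < t < 1 -> (heat_energy nu p t <= L%:E)%E.
  by move=> /andP[t0 _]; rewrite /L fineK//; exact: (integral_powR_heat_flow_le p1 q1 pq fi fnu t0).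
(* If F dropped below [c] at times arbitrarily close to 0, the sharp L^p bound with [c] in place of
   [C] would give L <= c. *)
have cF c : c < L -> \forall t \near 0^'+, (c%:E <= heat_energy nu p t)%E.
  move=> cL; apply: contrapT => H.
  have : (\int[lebesgue_rV R n]_x (`|f x| `^ p)%:E <= c%:E)%E.
    apply: (integral_powR_density_le p1 q1 pq fi fnu) => e e0.
    apply: contrapT => He; apply: H; near=> t.
    rewrite leNgt; apply/negP => Ft; apply: He; exists t; last exact: ltW.
    by apply/andP; split; near: t; [exact: nbhs_right_gt|exact: nbhs_right_lt].
  by rewrite -(fineK Iffin) lee_fin -/L leNgt cL.
have lim := cvg_integral_powR_abel p0 L0 F0 FL cF.
(* For every a > 0 the norm is given by the integral formula, because a density in L^p places [nu]
   in each of the spaces. *)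
apply: cvg_trans lim; apply: near_eq_cvg; near=> a.
have a0 : 0 < a by near: a; exact: nbhs_right_gt.
rewrite -neg_sobolev_norm_powR//.
exact: neg_sobolev_Lp fLp fnu.
Unshelve. all: by end_near. Qed.
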